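(* Let $\mathcal{H}$ be a class of distribution functions on $\mathbb{R}$ such that $\int_{\mathbb{R}} x\,H\{dx\} = 0$ and $\int_{\mathbb{R}} x^2\,H\{dx\} = 1$ for all $H\in\mathcal{H}$, and $$\lim_{c\to\infty}\ \sup_{H\in\mathcal{H}} \int_{|x|>c} x^2\,H\{dx\} = 0.$$ For $\kappa > 0$ let $\mathcal{R}_\kappa$ be the collection of pairs $(\bm{a},\Gamma)$ such that $\bm{a}=(a_{r,s}:r,s\in\mathbb{Z})$ is a square summable real array with $\Vert\bm{a}\Vert_2 > 0$, $\Gamma\subset\mathbb{Z}^2$ is a finite rectangle, and $\sigma(\bm{a},\Gamma) \ge \kappa \Vert\bm{a}\Vert_2$. Then, as $\kappa\to\infty$, the distributions of $S/\sigma$ converge to $\Phi$ uniformly with respect to $(\bm{a},\Gamma)\in\mathcal{R}_\kappa$ and $F\in\mathcal{H}$; that is, for every $\epsilon>0$ there exists $\kappa_0>0$ such that for all $\kappa\ge\kappa_0$, $$\sup_{z\in\mathbb{R}} |G(z;\bm{a},\Gamma,F)-\Phi(z)| \le \epsilon \quad \text{for all } (\bm{a},\Gamma)\in\mathcal{R}_\kappa \text{ and all } F\in\mathcal{H}.$$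
   Context: Let $\bm{a} = (a_{r,s}: r,s\in\mathbb{Z}) \in \ell^2(\mathbb{Z}^2)$ be a square summable real array with $\Vert\bm{a}\Vert_2 = \left[\sum_{r,s\in\mathbb{Z}} |a_{r,s}|^2\right]^{1/2}$, and let $\xi_{r,s}$, $r,s\in\mathbb{Z}$, be i.i.d. real random variables with mean $0$, variance $1$ and common distribution function $F$. The linear random field is $$X_{j,k} = \sum_{r\in\mathbb{Z}}\sum_{s\in\mathbb{Z}} a_{r,s}\,\xi_{j-r,k-s}, \quad (j,k)\in\mathbb{Z}^2$$ (the series converging in $L^2$). For a finite set $\Gamma\subset\mathbb{Z}^2$ put $S = S(\bm{a},\Gamma) = \sum_{(j,k)\in\Gamma} X_{j,k}$ and $$b_{r,s} = b_{r,s}(\bm{a},\Gamma) = \sum_{(j,k)\in\Gamma} a_{j+r,k+s},$$ so that $S = \sum_{r,s\in\mathbb{Z}} b_{r,s}\,\xi_{-r,-s}$. Let $\sigma^2 = \sigma^2(\bm{a},\Gamma) = E(S^2) = \sum_{r,s\in\mathbb{Z}} b_{r,s}^2$, with $\sigma=\sigma(\bm{a},\Gamma)\ge 0$, and, when $\sigma>0$, $$G(z) = G(z;\bm{a},\Gamma,F) = P\left[\frac{S}{\sigma} \le z\right],\ z\in\mathbb{R}.$$ $\Phi$ denotes the standard normal distribution function, and $\int f(x)\,H\{dx\}$ denotes integration with respect to the probability measure with distribution function $H$. A (finite) rectangle in $\mathbb{Z}^2$ is a non-empty set of the form $\{(j,k)\in\mathbb{Z}^2 : \underline{M}\le j\le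 \overline{M},\ \underline{N}\le k\le\overline{N}\}$ with integers $\underline{M}\le\overline{M}$, $\underline{N}\le\overline{N}$. *)

(* Defs.v *)
From mathcomp Require Import all_boot all_order all_algebra finmap.
From mathcomp Require Import all_classical all_reals all_analysis.

Set Implicit Arguments.
Unset Strict Implicit.
Unset Printing Implicit Defensive.

Import Order.TTheory GRing.Theory Num.Theory.
Import numFieldNormedType.Exports.

Local Open Scope classical_set_scope.
Local Open Scope ring_scope.

(* The lattice Z^2, with its componentwise additive group structure. *)
Notation ZZ := (int * int)%type.

(* Any distribution function on R; [lebesgue_stieltjes_measure H] is the
   probability measure with distribution function H. *)
Notation distribution_function R := (cumulativeBounded (0 : R) (1 : R)).

Definition square_summable (R : realType) (a : ZZ -> R) : Prop :=
  (\esum_(rs in [set: ZZ]) (a rs ^+ 2)%:E < +oo)%E.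

(* Meaningful for square summable arrays only: [fine +oo] is 0. *)
Definition l2norm (R : realType) (a : ZZ -> R) : R :=
  Num.sqrt (fine (\esum_(rs in [set: ZZ]) (a rs ^+ 2)%:E)).

Definition finite_rectangle (Gamma : {fset ZZ}) : Prop :=
  exists M1 M2 N1 N2 : int, [/\ M1 <= M2, N1 <= N2 &
    forall jk : ZZ,
      (jk \in Gamma) = (M1 <= jk.1 <= M2) && (N1 <= jk.2 <= N2)].

Definition bcoef (R : realType) (a : ZZ -> R) (Gamma : {fset ZZ}) (rs : ZZ) : R :=
  \sum_(jk <- Gamma) a (jk + rs).

(* If a is square summable then so is bcoef a Gamma, a finite sum of
   translates of a. *)
Definition sigma (R : realType) (a : ZZ -> R) (Gamma : {fset ZZ}) : R :=
  l2norm (bcoef a Gamma).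

Definition Rclass (R : realType) (kappa : R) : set ((ZZ -> R) * {fset ZZ}) :=
  [set aG | [/\ square_summable aG.1, 0 < l2norm aG.1,
                finite_rectangle aG.2 &
                kappa * l2norm aG.1 <= sigma aG.1 aG.2]].

Definition mutually_independent d (T : measurableType d) (R : realType)
    (P : probability T R) (I : choiceType) (X : I -> {RV P >-> R}) : Prop :=
  forall (J : {fset I}) (B : I -> set R),
    (forall i, i \in J -> measurable (B i)) ->
    (P (\bigcap_(i in [set` J]) (X i @^-1` B i)) =
     \prod_(i <- J) P (X i @^-1` B i))%E.

Definition iid d (T : measurableType d) (R : realType) (P : probability T R)
    (I : choiceType) (F : distribution_function R)
    (X : I -> {RV P >-> R}) : Prop :=
  mutually_independent X /\ forall i z, cdf (X i) z = (F z)%:E.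

(* Y is the sum in L^2(P) of the family f: the finite partial sums, directed by
   inclusion, converge to Y in mean square. *)
Definition is_L2_sum d (T : measurableType d) (R : realType)
    (P : probability T R) (I : choiceType) (f : I -> T -> R) (Y : T -> R) :
    Prop :=
  forall e : R, 0 < e -> exists A0 : {fset I}, forall A : {fset I},
    (A0 `<=` A)%fset ->
    ('E_P[fun w => ((Y w - \sum_(i <- A) f i w) ^+ 2)%R] <= e%:E)%E.

Definition linear_random_field d (T : measurableType d) (R : realType)
    (P : probability T R) (a : ZZ -> R) (xi X : ZZ -> {RV P >-> R}) : Prop :=
  forall jk : ZZ, is_L2_sum P (fun rs w => a rs * xi (jk - rs) w) (X jk).

Definition Ssum d (T : measurableType d) (R : realType) (P : probability T R)
    (X : ZZ -> {RV P >-> R}) (Gamma : {fset ZZ}) (w : T) : R :=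
  \sum_(jk <- Gamma) X jk w.

Definition Gdf d (T : measurableType d) (R : realType) (P : probability T R)
    (a : ZZ -> R) (X : ZZ -> {RV P >-> R}) (Gamma : {fset ZZ}) (z : R) : R :=
  fine (P [set w | Ssum X Gamma w / sigma a Gamma <= z]).

Definition Phi (R : realType) (z : R) : R :=
  fine (normal_prob 0 1 `]-oo, z]).

(* Main.v *)
Require Import Defs.
From HB Require Import structures.
From mathcomp Require Import all_boot all_order all_algebra finmap.
From mathcomp Require Import all_classical all_reals all_analysis.
From mathcomp Require Import measurable_realfun ring lra zify.

Import Order.TTheory GRing.Theory Num.Theory.
Import numFieldNormedType.Exports.

Local Open Scope classical_set_scope.
Local Open Scope ring_scope.

(** The partial sum [S] is a weighted sum of the independent innovations with
    weights [bcoef a Gamma], so this is a central limit theorem for weighted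
    sums, and everything rests on one Lindeberg-type fact: no single weight is
    large compared with [sigma].

    The fact is deterministic ([bcoef_sup_le]).  The mixed second difference of
    the weights over a [p] by [q] box collapses, because [Gamma] is a rectangle,
    to four corner blocks of [a], and is therefore at most
    [4 * p * q * l2norm a].  If a weight were large, then for each of the boxes
    with [1 <= p, q <= N] one of the other three corners would carry a large
    weight too; these weights would have a square sum of order [N], whereas they
    only have [sigma ^+ 2] at their disposal.  Hence every weight is at most
    [4 * N ^+ 2 * l2norm a + 3 * sigma / Num.sqrt N], which is a small multiple
    of [sigma] as soon as [N] is large and [sigma / l2norm a] is much larger
    still.  Relative to [sigma], the bound depends on [a] and [Gamma] through that
    ratio only.

    The central limit theorem is proved by the Lindeberg-Trotter replacement
    method ([lindeberg_replacement]), whose error bound only involves the largest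
    weight and the truncated second moments, hence is uniform over the class of
    distribution functions.  Replacing one innovation by a Gaussian one is done
    at the level of averaging operators: for a test function [f], the operators
    [f |-> E f(x + c * xi)] and [f |-> E f(x + c * Z)] both agree with
    [f + c ^+ 2 / 2 * f''] up to a small error ([average_taylor2]), both preserve
    the class of test functions with the same constants ([smooth_test_average]),
    and the Gaussian ones form a convolution semigroup ([gauss_averageD]).
    Working with operators makes it unnecessary to realise Gaussian variables on
    the given probability space.

    The test functions are cubic spline approximations of the indicator of a
    half-line ([smooth_cutoff]); their constants do not depend on where the jump
    is, so that the comparison of distribution functions is uniform in [z].  The
    infinite sum defining [S] is cut to a finite one using convergence in mean
    square ([Ssum_approx], [smooth_limit]). *)

(** * The weights of a rectangle sum *)

Section BoxSums.
Context {R : realType}.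
Implicit Types (g : nat -> nat -> R) (m n p q : nat).

(** Split the sum of [g] over [0, m + p) once at [p] and once at [m]. *)
Lemma window_shift (g : nat -> R) m p :
  \sum_(i < m) g (p + i)%N - \sum_(i < m) g i =
  \sum_(i < p) (g (m + i)%N - g i).
Proof.
have split_at k l : \sum_(i < k + l) g i = \sum_(i < k) g i + \sum_(i < l) g (k + i)%N.
  by rewrite big_split_ord.
rewrite sumrB; have := split_at m p; rewrite addnC split_at => E.
by apply/eqP; rewrite subr_eq addrAC eq_sym subr_eq addrC -E addrC.
Qed.

Definition box_sum g m n p q := \sum_(i < m) \sum_(k < n) g (p + i)%N (q + k)%N.

(** Shifting the window in one direction leaves boundary terms only; doing so in
    both directions leaves the four corner blocks, whose size does not depend on
    [m] and [n]. *)
Lemma box_sum_mixed_difference g m n p q :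
  box_sum g m n p q - box_sum g m n 0 q - (box_sum g m n p 0 - box_sum g m n 0 0) =
  \sum_(i < p) \sum_(k < q)
    (g (m + i)%N (n + k)%N - g (m + i)%N k - (g i (n + k)%N - g i k)).
Proof.
rewrite /box_sum.
rewrite (window_shift (fun i => \sum_(k < n) g i (q + k)%N)).
rewrite (window_shift (fun i => \sum_(k < n) g i (0 + k)%N)).
rewrite -sumrB; apply: eq_bigr => i _.
rewrite sumrB -!window_shift.
under [X in _ - (X - _) = _]eq_bigr do rewrite add0n.
under [X in _ - (_ - X) = _]eq_bigr do rewrite add0n.
by ring.
Qed.

Lemma box_sum_mixed_difference_le g m n p q (A : R) :
  (forall i k, `|g i k| <= A) ->
  `|box_sum g m n p q - box_sum g m n 0 q - (box_sum g m n p 0 - box_sum g m n 0 0)|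
  <= 4 * A * (p * q)%:R.
Proof.
move=> gA; rewrite box_sum_mixed_difference.
have -> : 4 * A * (p * q)%:R = \sum_(i < p) \sum_(k < q) (4 * A).
  by rewrite !big_const_ord !iter_addr_0 -mulrnA mulr_natr mulnC.
apply: (le_trans (ler_norm_sum _ _ _)); apply: ler_sum => i _.
apply: (le_trans (ler_norm_sum _ _ _)); apply: ler_sum => k _.
have -> : 4 * A = A + A + (A + A) by ring.
apply: (le_trans (ler_normB _ _)); apply: lerD;
  by apply: (le_trans (ler_normB _ _)); apply: lerD.
Qed.

(** A discrete Sobolev-type inequality.  When the mixed differences are small, a
    large value at the corner forces, for every [p] and [q], a large value at
    one of [(p, q)], [(p, 0)], [(0, q)].  Summing the squares over
    [1 <= p, q <= N], the two axes are counted [N] times each, so that the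
    [N ^ 2] boxes share a total of at most [(1 + 2 * N) * s ^+ 2]; the choice
    [N = K ^ 2] keeps square roots out of the bound. *)
Lemma box_sum_corner_le g m n (A s : R) (K : nat) :
  (0 < K)%N -> 0 <= s ->
  (forall i k, `|g i k| <= A) ->
  (forall N, \sum_(p < N) \sum_(q < N) (box_sum g m n p q) ^+ 2 <= s ^+ 2) ->
  `|box_sum g m n 0 0| <= 4 * (K ^ 4)%:R * A + 3 * s / K%:R.
Proof.
move=> K0 s0 gA gs.
set N := (K ^ 2)%N; set B := box_sum g m n in gs *.
set D := 4 * (K ^ 4)%:R * A.
have A0 : 0 <= A by apply: le_trans (gA 0%N 0%N).
have D0 : 0 <= D by rewrite !mulr_ge0.
have K0' : 0 < K%:R :> R by rewrite ltr0n.
have [le|lt] := leP `|B 0%N 0%N| D.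
  by apply: (le_trans le); rewrite lerDl divr_ge0// mulr_ge0.
set M := `|B 0%N 0%N| - D.
have M0 : 0 <= M by rewrite subr_ge0 ltW.
have key p q : (p < N)%N -> (q < N)%N ->
    M ^+ 2 <= 3 * (B p.+1 q.+1 ^+ 2 + B p.+1 0%N ^+ 2 + B 0%N q.+1 ^+ 2).
  move=> pN qN.
  have pq : (p.+1 * q.+1)%:R <= (K ^ 4)%:R :> R.
    by rewrite ler_nat (_ : (K ^ 4)%N = (N * N)%N) ?leq_mul// /N -expnD.
  have := box_sum_mixed_difference_le g m n p.+1 q.+1 A gA.
  rewrite -/B => dB.
  have dB' : `|B p.+1 q.+1 - B 0%N q.+1 - (B p.+1 0%N - B 0%N 0%N)| <= D.
    apply: (le_trans dB); rewrite /D -mulrA (mulrC A) mulrA.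
    by rewrite ler_wpM2r// ler_wpM2l.
  have MB : M <= `|B p.+1 q.+1 - B 0%N q.+1 - B p.+1 0%N|.
    rewrite lerBlDr; apply: le_trans (lerD (lexx _) dB').
    set u := B p.+1 q.+1; set v := B 0%N q.+1; set w := B p.+1 0%N.
    have {1}-> : B 0%N 0%N = - (u - v - w) + (u - v - (w - B 0%N 0%N)) by ring.
    by apply: (le_trans (ler_normD _ _)); rewrite normrN.
  apply: (@le_trans _ _ (`|B p.+1 q.+1 - B 0%N q.+1 - B p.+1 0%N| ^+ 2)).
    by rewrite ler_sqr ?nnegrE.
  rewrite real_normK ?num_real//.
  set u := B p.+1 q.+1; set v := B 0%N q.+1; set w := B p.+1 0%N.
  have h1 := sqr_ge0 (u + v); have h2 := sqr_ge0 (u + w); have h3 := sqr_ge0 (v - w).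
  rewrite -subr_ge0 (_ : _ - _ = (u + v) ^+ 2 + (u + w) ^+ 2 + (v - w) ^+ 2); last by ring.
  by rewrite !addr_ge0.
have split1 (f : nat -> R) : \sum_(p < N.+1) f p = f 0%N + \sum_(p < N) f p.+1.
  by rewrite big_ord_recl.
have := gs N.+1; rewrite (split1 (fun p => \sum_(q < N.+1) B p q ^+ 2)).
rewrite (split1 (fun q => B 0%N q ^+ 2)).
under [X in _ + X <= _]eq_bigr => p _ do rewrite (split1 (fun q => B p.+1 q ^+ 2)).
rewrite big_split /=.
set S0 := \sum_(q < N) B 0%N q.+1 ^+ 2.
set S1 := \sum_(p < N) B p.+1 0%N ^+ 2.
set S2 := \sum_(p < N) \sum_(q < N) B p.+1 q.+1 ^+ 2.
have S00 : 0 <= S0 by apply: sumr_ge0 => *; exact: sqr_ge0.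
have S10 : 0 <= S1 by apply: sumr_ge0 => *; exact: sqr_ge0.
have S20 : 0 <= S2 by do 2 (apply: sumr_ge0 => ? _); exact: sqr_ge0.
have B00 := sqr_ge0 (B 0%N 0%N).
move=> sum_le.
have NM : N%:R * (N%:R * M ^+ 2) <= 3 * (S2 + N%:R * S1 + N%:R * S0).
  have -> : N%:R * (N%:R * M ^+ 2) = \sum_(p < N) \sum_(q < N) M ^+ 2.
    by rewrite !sumr_const !card_ord !mulr_natl.
  have -> : S2 + N%:R * S1 + N%:R * S0 = \sum_(p < N) \sum_(q < N)
      (B p.+1 q.+1 ^+ 2 + B p.+1 0%N ^+ 2 + B 0%N q.+1 ^+ 2).
    under [RHS]eq_bigr do rewrite !big_split /=.
    rewrite !big_split /= -/S2; congr (_ + _ + _).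
      under [RHS]eq_bigr do rewrite sumr_const card_ord.
      by rewrite sumrMnl mulr_natl.
    by rewrite sumr_const card_ord mulr_natl.
  rewrite mulr_sumr; apply: ler_sum => p _; rewrite mulr_sumr.
  by apply: ler_sum => q _; exact: key.
have N1 : 1 <= N%:R :> R by rewrite ler1n /N expn_gt0 K0.
have KM : (K%:R * M) ^+ 2 <= (3 * s) ^+ 2.
  have -> : (K%:R * M) ^+ 2 = N%:R * M ^+ 2 by rewrite exprMn /N natrX.
  rewrite -(ler_pM2l (lt_le_trans ltr01 N1)); apply: (le_trans NM).
  apply: (@le_trans _ _ (N%:R * (3 * (S2 + S1 + S0)))).
    rewrite mulrCA ler_pM2l// !mulrDr !lerD2r.
    by rewrite ler_peMl.
  rewrite ler_pM2l ?(lt_le_trans ltr01 N1)// (_ : (3 * s) ^+ 2 = 9 * s ^+ 2); last by ring.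
  by lra.
have {KM} : K%:R * M <= 3 * s.
  by rewrite -ler_sqr ?nnegrE// mulr_ge0// ltW.
by rewrite mulrC -ler_pdivlMr// /M lerBlDr [leRHS]addrC.
Qed.

End BoxSums.

Section SquareSummable.
Context {R : realType}.
Implicit Types (a f : ZZ -> R) (Gamma : {fset ZZ}).

Lemma l2norm_ge0 f : 0 <= l2norm f.
Proof. exact: sqrtr_ge0. Qed.

Lemma sqr_esum_ge0 f : (0 <= \esum_(i in [set: ZZ]) (f i ^+ 2)%:E)%E.
Proof. by apply: esum_ge0 => i _; rewrite lee_fin sqr_ge0. Qed.

Lemma sqr_l2norm f : square_summable f ->
  (l2norm f ^+ 2)%:E = (\esum_(i in [set: ZZ]) (f i ^+ 2)%:E)%E.
Proof.
move=> sf; rewrite /l2norm sqr_sqrtr; last by rewrite fine_ge0// sqr_esum_ge0.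
by rewrite fineK// ge0_fin_numE// sqr_esum_ge0.
Qed.

Lemma sum_sqr_le f (s : seq ZZ) : square_summable f -> uniq s ->
  \sum_(i <- s) f i ^+ 2 <= l2norm f ^+ 2.
Proof.
move=> sf us; rewrite -lee_fin sqr_l2norm// -sumEFin.
apply: ereal_sup_ubound; exists [set` s]; last by rewrite -fsbig_seq.
by split => //; exact: finite_seq.
Qed.

Lemma sum_sqr_approx f (e : R) : square_summable f -> 0 < e ->
  exists A : {fset ZZ}, l2norm f ^+ 2 - e <= \sum_(i <- A) f i ^+ 2.
Proof.
move=> sf e0.
have : ((l2norm f ^+ 2 - e)%:E < \esum_(i in [set: ZZ]) (f i ^+ 2)%:E)%E.
  by rewrite -sqr_l2norm// lte_fin gtrBl.
move=> /ereal_sup_gt[_ [A [fA _] <-]] /ltW.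
rewrite fsbig_finite// sumEFin lee_fin => le_sum.
by exists (fset_set A).
Qed.

Lemma le_l2norm f i : square_summable f -> `|f i| <= l2norm f.
Proof.
move=> sf; rewrite -ler_sqr ?nnegrE ?l2norm_ge0// real_normK ?num_real//.
by have := sum_sqr_le f [:: i] sf isT; rewrite big_seq1.
Qed.

(** Of an infinite sum [fine] makes [0], so a positive norm certifies square
    summability. *)
Lemma square_summable_l2norm_gt0 f : 0 < l2norm f -> square_summable f.
Proof.
rewrite /l2norm sqrtr_gt0 /square_summable.
by case: (esum _ _) => [r _| |] //=; rewrite ?ltxx ?ltry.
Qed.

(** Turns a rectangle into a product of two windows, the form in which mixed
    differences can be computed. *)
Lemma finite_rectangle_enum Gamma : finite_rectangle Gamma ->
  exists (M N : int) (m n : nat), forall F : ZZ -> R,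
    \sum_(jk <- Gamma) F jk = \sum_(i < m) \sum_(k < n) F (M + i%:Z, N + k%:Z).
Proof.
move=> [M1 [M2 [N1 [N2 [M12 N12 mem]]]]].
exists M1, N1, `|M2 - M1|%N.+1, `|N2 - N1|%N.+1 => F.
set m := _.+1; set n := _.+1.
pose h (u : nat * nat) : ZZ := (M1 + u.1%:Z, N1 + u.2%:Z).
have -> : \sum_(i < m) \sum_(k < n) F (M1 + i%:Z, N1 + k%:Z) =
  \sum_(i <- index_iota 0 m) \sum_(k <- index_iota 0 n) (F \o h) (i, k).
  by rewrite big_mkord; apply: eq_bigr => i _; rewrite big_mkord.
rewrite -big_allpairs -(big_map h xpredT F).
have hI : injective h by move=> [i k] [i' k'] [] /addrI[->] /addrI[->].
apply: perm_big; apply: uniq_perm.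
- exact: fset_uniq.
- by rewrite map_inj_uniq// allpairs_uniq ?iota_uniq// => -[i k] [i' k'] _ _ [-> ->].
move=> [j k]; rewrite mem; apply/idP/mapP => [jk|[u /allpairsP[[i' k'] []]]].
  exists (`|j - M1|%N, `|k - N1|%N); last first.
    by rewrite /h; move: jk => /= /andP[] ? ?; congr pair; lia.
  apply/allpairsP; exists (`|j - M1|%N, `|k - N1|%N).
  by move: jk => /= jk; rewrite !mem_index_iota /m /n; split=> //; lia.
by rewrite /= !mem_index_iota /m /n => i1 k1 -> [-> ->]; lia.
Qed.

(** With [kappa * l2norm a <= sigma a Gamma], dividing by [sigma a Gamma] leaves
    [4 * K ^ 4 / kappa + 3 / K]: taking [K] and then [kappa] large makes all the
    normalised weights uniformly small. *)
Lemma bcoef_sup_le a Gamma (K : nat) rs : (0 < K)%N ->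
  square_summable a -> finite_rectangle Gamma -> 0 < sigma a Gamma ->
  `|bcoef a Gamma rs| <= 4 * (K ^ 4)%:R * l2norm a + 3 * sigma a Gamma / K%:R.
Proof.
move=> K0 sa /finite_rectangle_enum[M [N [m [n sumE]]]] s0.
have sb := square_summable_l2norm_gt0 _ s0.
pose g (i k : nat) := a ((M + i%:Z, N + k%:Z) + rs).
have gE p q : box_sum g m n p q = bcoef a Gamma (rs.1 + p%:Z, rs.2 + q%:Z).
  rewrite /bcoef sumE; apply: eq_bigr => i _; apply: eq_bigr => k _.
  have addE (u v : ZZ) : u + v = (u.1 + v.1, u.2 + v.2) by [].
  by rewrite /g; congr a; rewrite !addE; congr pair => /=; lia.
have -> : bcoef a Gamma rs = box_sum g m n 0 0 by rewrite gE !addr0 -surjective_pairing.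
apply: box_sum_corner_le => //; first exact: ltW.
- by move=> i k; exact: le_l2norm.
- move=> L; pose h (u : nat * nat) : ZZ := (rs.1 + u.1%:Z, rs.2 + u.2%:Z).
  have hI : injective h by move=> [i k] [i' k'] [] /addrI[->] /addrI[->].
  rewrite [leLHS](_ : _ = \sum_(v <-
      [seq h u | u <- [seq (p, q) | p <- index_iota 0 L, q <- index_iota 0 L]])
        bcoef a Gamma v ^+ 2); last first.
    rewrite big_map big_allpairs.
    rewrite big_mkord; apply: eq_bigr => p _; rewrite big_mkord.
    by apply: eq_bigr => q _; rewrite gE.
  apply: sum_sqr_le => //.
  by rewrite map_inj_uniq// allpairs_uniq ?iota_uniq// => -[i k] [i' k'] _ _ [-> ->].
Qed.

End SquareSummable.

(** * Test functions *)

Section TestFunctions.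
Context {R : realType}.
Implicit Types (f : R -> R) (M x y h : R).

Definition bounded_lipschitz M f : Prop :=
  (forall x, `|f x| <= M) /\ (forall x y, `|f x - f y| <= M * `|x - y|).

Definition taylor2_rem f f1 f2 x h : R :=
  f (x + h) - f x - h * f1 x - h ^+ 2 / 2 * f2 x.

(** The innovations only have two moments: the cubic bound serves where they are
    moderate, the quadratic one on their tails. *)
Definition taylor2_bounded M f f1 f2 : Prop := forall x h,
  `|taylor2_rem f f1 f2 x h| <= M * h ^+ 2 /\
  `|taylor2_rem f f1 f2 x h| <= M * `|h| ^+ 3.

(** Nonnegative bounded functions of class C^2 with bounded Lipschitz derivatives,
    described by Taylor estimates instead of derivatives: these estimates survive
    averaging over translates by mere linearity of the integral, with no
    differentiation under the integral sign, and with the same constant. *)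
Definition smooth_test M f : Prop :=
  (forall x, 0 <= f x) /\ exists f1 f2,
  [/\ bounded_lipschitz M f, bounded_lipschitz M f1, bounded_lipschitz M f2 &
      taylor2_bounded M f f1 f2].

Lemma bounded_lipschitz_gap M f : (forall x, `|f x| <= M) ->
  (forall x h, `|f (x + h) - f x| <= M * `|h|) -> bounded_lipschitz M f.
Proof.
move=> fM fL; split=> // x y.
by have := fL y (x - y); rewrite subrKC.
Qed.

Definition trunc_pow (k : nat) x : R := Num.max x 0 ^+ k.

Definition diff3 (u : R -> R) x : R := u x - 3 * u (x - 1) + 3 * u (x - 2) - u (x - 3).

(** The third difference of [max(x, 0) ^+ 3 / 6] is the primitive of the quadratic
    B-spline: it vanishes for [x <= 0] and equals [1] for [3 <= x].  The functions
    [step1] and [step2] are its first two derivatives. *)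
Definition step x : R := diff3 (trunc_pow 3) x / 6.
Definition step1 x : R := diff3 (trunc_pow 2) x / 2.
Definition step2 x : R := diff3 (trunc_pow 1) x.

Lemma diff3_le (u : R -> R) (C : R) x : (forall y, `|u y| <= C) -> `|diff3 u x| <= 8 * C.
Proof.
move=> uC; have := uC x; have := uC (x - 1); have := uC (x - 2); have := uC (x - 3).
rewrite /diff3 !ler_norml; set a := u x; set b := u _; set c := u _; set d := u _.
by move=> /andP[? ?] /andP[? ?] /andP[? ?] /andP[? ?]; apply/andP; split; lra.
Qed.

Lemma trunc_pow_cases x : (0 <= x /\ forall k, trunc_pow k x = x ^+ k) \/
  (x <= 0 /\ forall k, trunc_pow k x = 0 ^+ k).
Proof.
rewrite /trunc_pow; have [x0|/ltW x0] := leP 0 x; [left|right]; split=> // k.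
Qed.

Lemma trunc_pow1_rem x h : `|trunc_pow 1 (x + h) - trunc_pow 1 x| <= `|h|.
Proof.
rewrite ler_norml; have := ler_norm h; have := ler_norm (- h); rewrite normrN.
by case: (trunc_pow_cases (x + h)) => -[xh ->]; case: (trunc_pow_cases x) => -[x0 ->];
  rewrite ?expr1 ?expr0n /=; move=> ? ?; apply/andP; split; lra.
Qed.

Lemma trunc_pow2_rem x h :
  `|trunc_pow 2 (x + h) - trunc_pow 2 x - 2 * h * trunc_pow 1 x| <= h ^+ 2.
Proof.
rewrite ler_norml.
case: (trunc_pow_cases (x + h)) => -[xh ->]; case: (trunc_pow_cases x) => -[x0 E];
  rewrite !{}E ?expr1 ?expr0n /=; apply/andP; split; nra.
Qed.

(** When [x] and [x + h] have opposite signs, the remainder is [(x + h) ^+ 3] or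
    [h ^+ 3 - (x + h) ^+ 3], which lies between [0] and [h ^+ 3]. *)
Lemma trunc_pow3_rem x h :
  `|trunc_pow 3 (x + h) - trunc_pow 3 x - 3 * h * trunc_pow 2 x
    - 3 * h ^+ 2 * trunc_pow 1 x| <= `|h| ^+ 3.
Proof.
have mono (u v : R) : 0 <= u -> u <= v -> u ^+ 3 <= v ^+ 3.
  by move=> u0 uv; rewrite lerXn2r ?nnegrE// (le_trans u0).
have h3 : `|h| ^+ 3 = `|h ^+ 3| by rewrite normrX.
case: (trunc_pow_cases (x + h)) => -[xh ->]; case: (trunc_pow_cases x) => -[x0 E];
  rewrite !{}E ?expr1 ?expr0n /=.
- by rewrite h3 le_eqVlt; apply/orP; left; apply/eqP; congr `|_|; ring.
- have h0 : 0 <= h by lra.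
  rewrite !mulr0 !subr0 ger0_norm ?exprn_ge0// (ger0_norm h0); apply: mono => //; lra.
- have h0 : h <= 0 by lra.
  rewrite (ler0_norm h0) (_ : _ - _ = (- (x + h)) ^+ 3 - (- h) ^+ 3); last by ring.
  have p1 : (- (x + h)) ^+ 3 <= (- h) ^+ 3 by apply: mono; lra.
  have p2 : 0 <= (- (x + h)) ^+ 3 by apply: exprn_ge0; lra.
  by rewrite ler_norml; apply/andP; split; lra.
- by rewrite !mulr0 !subr0 normr0 exprn_ge0.
Qed.

Lemma step_rem3 x h : `|taylor2_rem step step1 step2 x h| <= 2 * `|h| ^+ 3.
Proof.
pose u y := trunc_pow 3 (y + h) - trunc_pow 3 y - 3 * h * trunc_pow 2 y
    - 3 * h ^+ 2 * trunc_pow 1 y.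
have -> : taylor2_rem step step1 step2 x h = diff3 u x / 6.
  rewrite /taylor2_rem /step /step1 /step2 /diff3 /u.
  rewrite (addrAC x h (-1)) (addrAC x h (-2)) (addrAC x h (-3)).
  by field.
have := diff3_le u (`|h| ^+ 3) x (fun y => trunc_pow3_rem y h).
rewrite normrM (ger0_norm (_ : 0 <= 6^-1))// ler_pdivrMr// => /le_trans; apply.
have : 0 <= `|h| ^+ 3 by rewrite exprn_ge0. 
by move=> ?; lra.
Qed.

Lemma step1_rem x h : `|step1 (x + h) - step1 x - h * step2 x| <= 4 * h ^+ 2.
Proof.
pose u y := trunc_pow 2 (y + h) - trunc_pow 2 y - 2 * h * trunc_pow 1 y.
have -> : step1 (x + h) - step1 x - h * step2 x = diff3 u x / 2.
  rewrite /step1 /step2 /diff3 /u.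
  rewrite (addrAC x h (-1)) (addrAC x h (-2)) (addrAC x h (-3)).
  by field.
have := diff3_le u (h ^+ 2) x (fun y => trunc_pow2_rem y h).
rewrite normrM (ger0_norm (_ : 0 <= 2^-1))// ler_pdivrMr// => /le_trans; apply.
by lra.
Qed.

Lemma step2_rem x h : `|step2 (x + h) - step2 x| <= 8 * `|h|.
Proof.
pose u y := trunc_pow 1 (y + h) - trunc_pow 1 y.
have -> : step2 (x + h) - step2 x = diff3 u x.
  rewrite /step2 /diff3 /u.
  rewrite (addrAC x h (-1)) (addrAC x h (-2)) (addrAC x h (-3)).
  by ring.
exact: diff3_le (fun y => trunc_pow1_rem y h).
Qed.

Ltac step_cases x :=
  case: (trunc_pow_cases x) => -[? ->]; case: (trunc_pow_cases (x - 1)) => -[? ->];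
  case: (trunc_pow_cases (x - 2)) => -[? ->]; case: (trunc_pow_cases (x - 3)) => -[? ->];
  rewrite ?expr1 ?expr0n /=.

Lemma step_ge0_le1 x : 0 <= step x <= 1.
Proof.
rewrite /step /diff3.
step_cases x; try (exfalso; lra).
- by rewrite (_ : _ / _ = 1) ?ler01 ?lexx//; field.
- have h3 : 0 <= (3 - x) ^+ 3 by rewrite exprn_ge0; lra.
  have h4 : (3 - x) ^+ 3 <= 1 by rewrite exprn_ile1; lra.
  rewrite (_ : _ / _ = 1 - (3 - x) ^+ 3 / 6); last by field.
  by apply/andP; split; lra.
- set t := x - 1.
  rewrite (_ : _ / _ = (1 + 3 * t * (1 + t * (1 - t)) + t ^+ 3) / 6); last first.
    by rewrite /t; field.
  have t0 : 0 <= t by rewrite /t; lra. have t1 : t <= 1 by rewrite /t; lra.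
  by apply/andP; split; nra.
- have h3 : 0 <= x ^+ 3 by rewrite exprn_ge0.
  have h4 : x ^+ 3 <= 1 by rewrite exprn_ile1//; lra.
  by apply/andP; split; lra.
- by rewrite !mulr0 !subr0 addr0 mul0r lexx ler01.
Qed.

Lemma step1_le x : `|step1 x| <= 1.
Proof.
rewrite /step1 /diff3 ler_norml.
by step_cases x; try (exfalso; lra); apply/andP; split; nra.
Qed.

Lemma step2_le x : `|step2 x| <= 1.
Proof.
rewrite /step2 /diff3 ler_norml.
by step_cases x; try (exfalso; lra); apply/andP; split; lra.
Qed.

Lemma step_le0 x : x <= 0 -> step x = 0.
Proof.
move=> x0; rewrite /step /diff3 /trunc_pow !max_r; [|lra|lra|lra|lra].
by rewrite expr0n /=; ring.
Qed.

Lemma step_ge3 x : 3 <= x -> step x = 1.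
Proof. move=> x0; rewrite /step /diff3 /trunc_pow !max_l; [by field|lra..]. Qed.

(** For increments [`|h| <= 1] all bounds follow from the Taylor remainders; for
    larger ones, from the boundedness of the functions. *)
Lemma smooth_test_step : smooth_test 8 step.
Proof.
have s01 x : `|step x| <= 1.
  by have /andP[a b] := step_ge0_le1 x; rewrite ger0_norm.
split; first by move=> x; have /andP[] := step_ge0_le1 x.
exists step1, step2; split.
- apply: bounded_lipschitz_gap => [x|x h]; first by apply: (le_trans (s01 x)); lra.
  have [h1|h1] := leP `|h| 1.
    have -> : step (x + h) - step x =
      taylor2_rem step step1 step2 x h + h * step1 x + h ^+ 2 / 2 * step2 x.
      by rewrite /taylor2_rem; ring.
    apply: (@le_trans _ _ (2 * `|h| ^+ 3 + `|h| * 1 + `|h| ^+ 2 / 2 * 1)).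
      apply: (le_trans (ler_normD _ _)); apply: lerD.
        apply: (le_trans (ler_normD _ _)); apply: lerD; first exact: step_rem3.
        by rewrite normrM ler_wpM2l// step1_le.
      rewrite normrM; apply: ler_pM => //; last exact: step2_le.
      by rewrite normrM normrX (ger0_norm (_ : 0 <= 2^-1)).
    have h0 := normr_ge0 h; set t := `|h| in h0 h1 *.
    have t2 : t ^+ 2 <= t by rewrite expr2 ler_piMl.
    have t3 : t ^+ 3 <= t by rewrite exprS ler_piMr// (le_trans t2).
    by lra.
  apply: (le_trans (ler_normB _ _)); apply: (le_trans (lerD (s01 _) (s01 _))); lra.
- apply: bounded_lipschitz_gap => [x|x h]; first by apply: (le_trans (step1_le x)); lra.
  have [h1|h1] := leP `|h| 1.
    have -> : step1 (x + h) - step1 x =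
      (step1 (x + h) - step1 x - h * step2 x) + h * step2 x by ring.
    apply: (le_trans (ler_normD _ _)).
    apply: (le_trans (lerD (step1_rem _ _) (_ : _ <= `|h| * 1))).
      by rewrite normrM ler_wpM2l// step2_le.
    rewrite -real_normK ?num_real//.
    have h0 := normr_ge0 h; set t := `|h| in h0 h1 *.
    have t2 : t ^+ 2 <= t by rewrite expr2 ler_piMl.
    by lra.
  apply: (le_trans (ler_normB _ _)).
  apply: (le_trans (lerD (step1_le _) (step1_le _))); lra.
- apply: bounded_lipschitz_gap => [x|x h]; last exact: step2_rem.
  by apply: (le_trans (step2_le x)); lra.
- move=> x h; split; last first.
    by apply: (le_trans (step_rem3 _ _)); rewrite ler_wpM2r ?exprn_ge0//; lra.
  rewrite -(real_normK (num_real h)).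
  have h0 := normr_ge0 h; have [h1|h1] := leP `|h| 1.
    apply: (le_trans (step_rem3 _ _)).
    have t2 : `|h| ^+ 3 <= `|h| ^+ 2 by rewrite exprS ler_piMl ?exprn_ge0.
    have : 0 <= `|h| ^+ 2 by rewrite exprn_ge0.
    by lra.
  apply: (@le_trans _ _ (1 + 1 + `|h| * 1 + `|h| ^+ 2 / 2 * 1)); last by nra.
  apply: (le_trans (ler_normB _ _)); apply: lerD; last first.
    rewrite normrM; apply: ler_pM => //; last exact: step2_le.
    by rewrite normrM normrX (ger0_norm (_ : 0 <= 2^-1)).
  apply: (le_trans (ler_normB _ _)); apply: lerD; last first.
    by rewrite normrM ler_wpM2l// step1_le.
  by apply: (le_trans (ler_normB _ _)); apply: lerD.
Qed.

Lemma smooth_test_affine M f (k b : R) : 1 <= `|k| -> smooth_test M f ->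
  smooth_test (M * `|k| ^+ 3) (fun x => f (k * x + b)).
Proof.
move=> k1 [f0 [f1 [f2 [[fM fL] [f1M f1L] [f2M f2L] fT]]]].
have M0 : 0 <= M by apply: le_trans (fM 0).
have k2 : 1 <= `|k| ^+ 2 by rewrite exprn_ege1.
have k3 : 1 <= `|k| ^+ 3 by rewrite exprn_ege1.
have k13 : `|k| <= `|k| ^+ 3 by rewrite exprS ler_peMr// (le_trans ler01).
have k23 : `|k| ^+ 2 <= `|k| ^+ 3 by rewrite (exprS _ 2) ler_peMl// exprn_ge0.
have argE x y : k * x + b - (k * y + b) = k * (x - y) by ring.
split=> //; exists (fun x => k * f1 (k * x + b)), (fun x => k ^+ 2 * f2 (k * x + b)).
split.
- split=> [x|x y]; first by apply: (le_trans (fM _)); rewrite ler_peMr.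
  apply: (le_trans (fL _ _)); rewrite argE normrM mulrA ler_wpM2r//.
  by rewrite ler_wpM2l.
- split=> [x|x y].
    by rewrite normrM mulrC; apply: ler_pM.
  rewrite -mulrBr normrM; apply: (le_trans (ler_wpM2l _ (f1L _ _))) => //.
  rewrite argE normrM [leLHS](_ : _ = M * `|k| ^+ 2 * `|x - y|); last by ring.
  by rewrite ler_wpM2r// ler_wpM2l.
- split=> [x|x y].
    by rewrite normrM normrX mulrC; apply: ler_pM.
  rewrite -mulrBr normrM normrX; apply: (le_trans (ler_wpM2l _ (f2L _ _))).
    by rewrite exprn_ge0.
  rewrite argE normrM [leLHS](_ : _ = M * `|k| ^+ 3 * `|x - y|); last by ring.
  by rewrite ler_wpM2r.
- move=> x h.
  have -> : taylor2_rem (fun x => f (k * x + b)) (fun x => k * f1 (k * x + b))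
     (fun x => k ^+ 2 * f2 (k * x + b)) x h = taylor2_rem f f1 f2 (k * x + b) (k * h).
    rewrite /taylor2_rem (_ : k * (x + h) + b = k * x + b + k * h); last by ring.
    by ring.
  have [t2 t3] := fT (k * x + b) (k * h); split.
    apply: (le_trans t2); rewrite exprMn mulrA ler_wpM2r ?sqr_ge0// ler_wpM2l//.
    by rewrite -(real_normK (num_real k)).
  by apply: (le_trans t3); rewrite normrM exprMn mulrA.
Qed.

End TestFunctions.

(** * Averaging over a random translation *)

Section BoundedLipschitz.
Context {R : realType}.
Implicit Types (f : R -> R) (M : R).

Lemma lipschitz_continuous M f : (forall x y, `|f x - f y| <= M * `|x - y|) ->
  continuous f.
Proof.
move=> fL x; apply/cvgrPdist_le => e e0.
have M0 : 0 <= M.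
  apply: le_trans (normr_ge0 (f 1 - f 0)) _.
  by rewrite (le_trans (fL 1 0))// subr0 normr1 mulr1.
have M1 : 0 < M + 1 by rewrite ltr_wpDl.
near=> y; apply: (le_trans (fL x y)).
apply: (@le_trans _ _ ((M + 1) * `|x - y|)); first by rewrite ler_wpM2r// lerDl.
rewrite mulrC -ler_pdivlMr//.
by near: y; apply: cvgr_dist_le => //; rewrite divr_gt0.
Unshelve. all: by end_near. Qed.

Lemma bounded_lipschitz_continuous M f : bounded_lipschitz M f -> continuous f.
Proof. by move=> [_ fL]; exact: lipschitz_continuous fL. Qed.

Lemma bounded_lipschitz_measurable M f : bounded_lipschitz M f ->
  measurable_fun [set: R] f.
Proof.
by move=> fL; apply: continuous_measurable_fun; exact: bounded_lipschitz_continuous fL.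
Qed.

End BoundedLipschitz.

Section Averages.
Context {d} {T : measurableType d} {R : realType} (P : probability T R).
Implicit Types (f : R -> R) (g Y : T -> R) (M : R).

Lemma bounded_integrable M g : measurable_fun [set: T] g -> (forall w, `|g w| <= M) ->
  P.-integrable [set: T] (EFin \o g).
Proof.
move=> mg gM; apply: (@le_integrable _ _ _ P _ measurableT _ (cst M%:E)).
- exact/measurable_EFinP.
- move=> w _ /=; rewrite lee_fin; apply: (le_trans (gM w)); exact: ler_norm.
- exact: finite_measure_integrable_cst.
Qed.

Lemma Rintegral_cstT (c : R) : \int[P]_w c = c.
Proof. by have /= PT := probability_setT P; rewrite Rintegral_cst//= PT mulr1. Qed.

Lemma normr_Rintegral_le M g : measurable_fun [set: T] g -> (forall w, `|g w| <= M) ->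
  `|\int[P]_w g w| <= M.
Proof.
move=> mg gM; have ig := bounded_integrable _ _ mg gM.
apply: (le_trans (le_normr_Rintegral measurableT ig)).
rewrite -[leRHS](Rintegral_cstT M); apply: le_Rintegral => //.
- exact: integrable_norm.
- exact: finite_measure_integrable_cst.
Qed.

Lemma measurable_norm_gt Y (L : R) : measurable_fun [set: T] Y ->
  measurable [set w | L < `|Y w|].
Proof.
move=> mY; rewrite (_ : [set w | _] = [set: T] `&` (fun w => `|Y w|) @^-1` `]L, +oo[).
  by apply: measurableT_comp => //; exact: measurable_itv.
by rewrite setTI; apply/seteqP; split=> w /=; rewrite in_itv /= andbT.
Qed.

Definition average Y f x := \int[P]_w f (x + Y w).

Lemma measurable_bl_shift M Y f x : measurable_fun [set: T] Y -> bounded_lipschitz M f ->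
  measurable_fun [set: T] (fun w => f (x + Y w)).
Proof.
move=> mY fM; apply: measurableT_comp; first exact: bounded_lipschitz_measurable fM.
exact: measurable_funD.
Qed.

Lemma integrable_bl_shift M Y f x : measurable_fun [set: T] Y -> bounded_lipschitz M f ->
  P.-integrable [set: T] (EFin \o (fun w => f (x + Y w))).
Proof.
move=> mY fM; apply: (bounded_integrable M); first exact: measurable_bl_shift fM.
by move=> w; exact: fM.1.
Qed.

Lemma bounded_lipschitz_average M Y f : measurable_fun [set: T] Y ->
  bounded_lipschitz M f -> bounded_lipschitz M (average Y f).
Proof.
move=> mY fM; split=> [x|x y].
  by apply: normr_Rintegral_le; [exact: measurable_bl_shift fM|move=> w; exact: fM.1].
rewrite /average -RintegralB//; [|exact: integrable_bl_shift fM..].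
apply: normr_Rintegral_le.
  by apply: measurable_funB; exact: measurable_bl_shift fM.
by move=> w; apply: (le_trans (fM.2 _ _)); rewrite (_ : x + Y w - (y + Y w) = x - y)//; ring.
Qed.

(** The Taylor remainder of an average is the average of the Taylor remainders. *)
Lemma smooth_test_average M Y f : measurable_fun [set: T] Y ->
  smooth_test M f -> smooth_test M (average Y f).
Proof.
move=> mY [f0 [f1 [f2 [fM f1M f2M fT]]]].
split; first by move=> x; apply: Rintegral_ge0.
exists (average Y f1), (average Y f2); split; try exact: bounded_lipschitz_average.
move=> x h.
have i0 z := integrable_bl_shift _ _ _ z mY fM.
have i1 z := integrable_bl_shift _ _ _ z mY f1M.
have i2 z := integrable_bl_shift _ _ _ z mY f2M.
have m0 z := measurable_bl_shift _ _ _ z mY fM.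
have m1 z := measurable_bl_shift _ _ _ z mY f1M.
have m2 z := measurable_bl_shift _ _ _ z mY f2M.
have -> : taylor2_rem (average Y f) (average Y f1) (average Y f2) x h =
    \int[P]_w taylor2_rem f f1 f2 (x + Y w) h.
  rewrite /taylor2_rem /average -!RintegralZl//.
  have iZ c (g : T -> R) : P.-integrable [set: T] (EFin \o g) ->
      P.-integrable [set: T] (EFin \o (fun w => c * g w)).
    by move=> ig; rewrite /comp; under eq_fun do rewrite EFinM; exact: integrableZl.
  have iB (g k : T -> R) : P.-integrable [set: T] (EFin \o g) ->
      P.-integrable [set: T] (EFin \o k) ->
      P.-integrable [set: T] (EFin \o (fun w => g w - k w)).
    by move=> ig ik; exact: (@integrableB _ _ _ P _ measurableT _ _ ig ik).
  have i01 := iB _ _ (i0 (x + h)) (i0 x).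
  have i012 := iB _ _ i01 (iZ h _ (i1 x)).
  rewrite -(RintegralB measurableT (i0 _) (i0 _)).
  rewrite -(RintegralB measurableT i01 (iZ h _ (i1 x))).
  rewrite -(RintegralB measurableT i012 (iZ _ _ (i2 x))).
  by apply: eq_Rintegral => w _; rewrite (addrAC x h).
have mr : measurable_fun [set: T] (fun w => taylor2_rem f f1 f2 (x + Y w) h).
  rewrite /taylor2_rem; apply: measurable_funB; last exact: measurable_funM.
  apply: measurable_funB; last exact: measurable_funM.
  apply: measurable_funB; last exact: m0.
  by under eq_fun do rewrite addrAC; exact: m0.
by split; apply: normr_Rintegral_le => // w; have [] := fT (x + Y w) h.
Qed.

Definition standardized Y : Prop :=
  [/\ measurable_fun [set: T] Y, (\int[P]_w (Y w)%:E = 0)%E &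
      (\int[P]_w (Y w ^+ 2)%:E = 1)%E].

Lemma standardized_integrable_sqr Y : standardized Y ->
  P.-integrable [set: T] (EFin \o (fun w => Y w ^+ 2)).
Proof.
move=> [mY _ Y2]; apply/integrableP; split.
  by apply/measurable_EFinP; exact: measurable_funX.
under eq_integral do rewrite /= ger0_norm ?sqr_ge0//.
by rewrite Y2 ltry.
Qed.

Lemma standardized_integrable Y : standardized Y -> P.-integrable [set: T] (EFin \o Y).
Proof.
move=> sY; have i2 := standardized_integrable_sqr _ sY.
have [mY _ _] := sY.
apply: (@le_integrable _ _ _ P _ measurableT _ (EFin \o (fun w => 1 + Y w ^+ 2))).
- exact/measurable_EFinP.
- move=> w _ /=; rewrite lee_fin [leRHS]ger0_norm ?addr_ge0 ?sqr_ge0//.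
  rewrite -(real_normK (num_real (Y w))); have := normr_ge0 (Y w).
  by set t := `|Y w|; have := sqr_ge0 (t - 1); nra.
- apply: (@integrableD _ _ _ P _ measurableT (cst 1%:E) (EFin \o (fun w => Y w ^+ 2))) => //.
  exact: finite_measure_integrable_cst.
Qed.

(** One step of the replacement method.  Only the first two moments of [Y] enter
    the main term, so that two standardized variables yield the same one.  The
    remainder is bounded by the quadratic estimate where [L < `|Y w|] and by the
    cubic one elsewhere, using [`|Y w| ^+ 3 <= L * Y w ^+ 2]. *)
Lemma average_taylor2 M Y f f1 f2 (L eta c x : R) : standardized Y ->
  0 <= L -> (\int[P]_(w in [set w | (L < `|Y w|)%R]) (Y w ^+ 2)%:E <= eta%:E)%E ->
  bounded_lipschitz M f -> taylor2_bounded M f f1 f2 ->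
  `|average (fun w => c * Y w) f x - (f x + c ^+ 2 / 2 * f2 x)|
    <= M * (c ^+ 2 * eta + `|c| ^+ 3 * L).
Proof.
move=> sY L0 tail fM fT.
have [mY Y1 Y2] := sY.
have i1 := standardized_integrable _ sY.
have i2 := standardized_integrable_sqr _ sY.
have M0 : 0 <= M by apply: le_trans (fM.1 0).
have mcY : measurable_fun [set: T] (fun w => c * Y w) by exact: measurable_funM.
have if0 := integrable_bl_shift _ _ _ x mcY fM.
have mf0 := measurable_bl_shift _ _ _ x mcY fM.
pose D := [set w | L < `|Y w|].
have mD : measurable D by exact: measurable_norm_gt.
pose q w := f x + c * f1 x * Y w + c ^+ 2 / 2 * f2 x * Y w ^+ 2.
have iZ (a : R) (g : T -> R) : P.-integrable [set: T] (EFin \o g) ->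
    P.-integrable [set: T] (EFin \o (fun w => a * g w)).
  by move=> ig; rewrite /comp; under eq_fun do rewrite EFinM; exact: integrableZl.
have iD (g h : T -> R) : P.-integrable [set: T] (EFin \o g) ->
    P.-integrable [set: T] (EFin \o h) ->
    P.-integrable [set: T] (EFin \o (fun w => g w + h w)).
  by move=> ig ih; exact: (@integrableD _ _ _ P _ measurableT (EFin \o g) (EFin \o h)).
have icst (a : R) : P.-integrable [set: T] (EFin \o (fun _ => a)).
  exact: finite_measure_integrable_cst.
have iq01 : P.-integrable [set: T] (EFin \o (fun w => f x + c * f1 x * Y w)).
  by apply: iD => //; exact: iZ.
have iq : P.-integrable [set: T] (EFin \o q) by apply: iD => //; exact: iZ.
have -> : f x + c ^+ 2 / 2 * f2 x = \int[P]_w q w.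
  rewrite /q RintegralD//; last exact: iZ.
  rewrite RintegralD//; last exact: iZ.
  rewrite !RintegralZl// Rintegral_cstT.
  by rewrite /Rintegral Y1 Y2 /= mulr0 addr0 mulr1.
rewrite /average -RintegralB//.
have -> : \int[P]_w (f (x + c * Y w) - q w) = \int[P]_w taylor2_rem f f1 f2 x (c * Y w).
  by apply: eq_Rintegral => w _; rewrite /q /taylor2_rem; ring.
have ir : P.-integrable [set: T] (EFin \o (fun w => taylor2_rem f f1 f2 x (c * Y w))).
  rewrite (_ : (fun w => _) = (fun w => f (x + c * Y w) + (-1) * q w)).
    by apply: iD => //; exact: iZ.
  by apply/funext => w; rewrite /q /taylor2_rem; ring.
apply: (le_trans (le_normr_Rintegral measurableT ir)).
pose bnd w := M * c ^+ 2 * (Y w ^+ 2 * \1_D w) + M * `|c| ^+ 3 * L * Y w ^+ 2.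
have iYD : P.-integrable [set: T] (EFin \o (fun w => Y w ^+ 2 * \1_D w)).
  apply: (@le_integrable _ _ _ P _ measurableT _ (EFin \o (fun w => Y w ^+ 2)) _ _ i2).
    apply/measurable_EFinP; apply: measurable_funM; first exact: measurable_funX.
    exact: measurable_indic.
  move=> w _ /=; rewrite lee_fin normrM ler_piMr//.
  by rewrite indicE; case: (_ \in _); rewrite ?normr1 ?normr0.
have ibnd : P.-integrable [set: T] (EFin \o bnd).
  by apply: iD; [exact: (iZ _ _ iYD)|exact: (iZ _ _ i2)].
apply: (@le_trans _ _ (\int[P]_w bnd w)).
  apply: le_Rintegral => //; first exact: integrable_norm.
  move=> w _; have [r2 r3] := fT x (c * Y w); rewrite /bnd indicE.
  have [wD|wD] := boolP (w \in D).
    rewrite mulr1; apply: (le_trans r2); rewrite exprMn mulrA lerDl.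
    exact: (mulr_ge0 (mulr_ge0 (mulr_ge0 M0 (exprn_ge0 3 (normr_ge0 c))) L0) (sqr_ge0 _)).
  have YL : `|Y w| <= L.
    by rewrite leNgt; apply/negP => YL; move/negP: wD; apply; rewrite inE.
  rewrite mulr0 mulr0 add0r; apply: (le_trans r3).
  rewrite normrM exprMn -(real_normK (num_real (Y w))).
  rewrite [leRHS](_ : _ = M * `|c| ^+ 3 * (L * `|Y w| ^+ 2)); last by ring.
  rewrite [leLHS]mulrA ler_wpM2l//; first by rewrite mulr_ge0 ?exprn_ge0.
  by rewrite exprS ler_wpM2r ?exprn_ge0.
have tail' : \int[P]_w (Y w ^+ 2 * \1_D w) <= eta.
  rewrite -lee_fin /Rintegral fineK; last exact: integrable_fin_num.
  apply: le_trans tail; rewrite [leRHS]integral_mkcond.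
  rewrite le_eqVlt; apply/orP; left; apply/eqP; apply: eq_integral => w _.
  by rewrite patchE indicE /=; case: ifP; rewrite ?mulr1 ?mulr0.
rewrite /bnd RintegralD//; [|exact: iZ..].
rewrite !RintegralZl// {2}/Rintegral Y2 /= mulr1 mulrDr !mulrA lerD2r.
by rewrite ler_wpM2l// -mulrA mulr_ge0// -expr2 sqr_ge0.
Qed.

End Averages.

(** * The Gaussian semigroup *)

Section Density.
Local Open Scope ereal_scope.
Context d (T : measurableType d) (R : realType).
Variables (mu nu : {measure set T -> \bar R}) (g : T -> R).
Hypotheses (mg : measurable_fun [set: T] g) (g0 : forall x, (0 <= g x)%R).
Hypothesis nuE : forall A, measurable A -> nu A = \int[mu]_(x in A) (g x)%:E.

Import HBNNSimple.

Let integral_density_nnsfun (f : {nnsfun T >-> R}) :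
  \int[nu]_x (f x)%:E = \int[mu]_x ((f x)%:E * (g x)%:E).
Proof.
under [LHS]eq_integral do rewrite fimfunE -fsumEFin//.
rewrite [LHS]ge0_integral_fsum//; last 2 first.
  - by move=> r; exact/measurable_EFinP/measurableT_comp.
  - by move=> n x _; rewrite EFinM nnfun_muleindic_ge0.
under [RHS]eq_integral.
  move=> x xD; rewrite fimfunE -fsumEFin// muleC ge0_mule_fsumr; last first.
    by move=> r; rewrite EFinM nnfun_muleindic_ge0.
  over.
rewrite [RHS]ge0_integral_fsum//; last 2 first.
  - move=> r; apply/emeasurable_funM; first exact/measurable_EFinP.
    by apply/measurable_EFinP/measurableT_comp.
  - move=> n x _; rewrite EFinM mule_ge0 ?lee_fin//.
    by rewrite -lee_fin EFinM nnfun_muleindic_ge0.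
apply: eq_fsbigr => r _.
rewrite integralZl_indic_nnsfun//= integral_indic//= setIT.
transitivity (r%:E * \int[mu]_(x in f @^-1` [set r]) (g x)%:E); first by rewrite nuE.
have [r0|r0] := ltP r 0%R.
  rewrite preimage_nnfun0// integral_set0 mule0; apply/esym.
  by rewrite integral0_eq// => x _; rewrite indic0 mulr0 mule0.
rewrite integral_mkcond -ge0_integralZl//=.
- apply: eq_integral => x _; rewrite patchE indicE; case: ifPn => _.
    by rewrite mulr1 muleC.
  by rewrite mulr0 !mule0.
- apply/(measurable_restrictT _ _).1 => //; exact/measurable_EFinP/measurable_funTS.
- by move=> x _; rewrite patchE; case: ifP => // _; rewrite lee_fin.
Qed.

(** Both sides agree on simple functions and are continuous along monotone
    limits. *)
Lemma ge0_integral_density (f : T -> \bar R) :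
  measurable_fun [set: T] f -> (forall x, 0 <= f x) ->
  \int[nu]_x f x = \int[mu]_x (f x * (g x)%:E).
Proof.
move=> mf f0; pose f_ := nnsfun_approx measurableT mf.
transitivity (limn (fun n => \int[nu]_x (f_ n x)%:E)).
  rewrite -monotone_convergence//=.
  - apply: eq_integral => ? /[!inE] xD; apply/esym/cvg_lim => //=.
    exact: cvg_nnsfun_approx.
  - by move=> n; exact/measurable_EFinP/measurable_funTS.
  - by move=> n ? _; rewrite lee_fin.
  - by move=> ? _ ? ? mn; rewrite lee_fin; exact/lefP/nd_nnsfun_approx.
transitivity (limn (fun n => \int[mu]_x ((f_ n x)%:E * (g x)%:E))).
  by apply: congr_lim; apply/funext => n; exact: integral_density_nnsfun.
rewrite -monotone_convergence//=.
- apply: eq_integral => x _; apply/cvg_lim => //=.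
  by apply: cvgeZr => //; exact: cvg_nnsfun_approx.
- move=> n; apply: emeasurable_funM; exact/measurable_EFinP/measurable_funTS.
- by move=> n x _; rewrite mule_ge0 ?lee_fin.
- move=> x _ m n mn; rewrite lee_wpmul2r ?lee_fin//.
  exact/lefP/nd_nnsfun_approx.
Qed.

End Density.

Section Gaussian.
Context {R : realType}.
Local Notation mu := (@lebesgue_measure R).
Local Notation N01 := (@normal_prob R 0 1).
Implicit Types (f : R -> R) (m s x y z : R).

Lemma ge0_integral_normal m s (f : R -> \bar R) :
  measurable_fun [set: R] f -> (forall x, 0 <= f x)%E ->
  (\int[normal_prob m s]_x f x = \int[mu]_x (f x * (normal_pdf m s x)%:E))%E.
Proof.
move=> mf f0; apply: ge0_integral_density => //.
- exact: measurable_normal_pdf.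
- exact: normal_pdf_ge0.
Qed.

Lemma normal_pdf_gt0E m s x : 0 < s ->
  normal_pdf m s x = normal_peak s * expR (- (x - m) ^+ 2 / (s ^+ 2 *+ 2)).
Proof. by move=> s0; rewrite normal_pdfE ?gt_eqF. Qed.

Lemma normal_peak_scale s : 0 < s -> s * normal_peak s = normal_peak 1.
Proof.
move=> s0; rewrite /normal_peak expr1n mul1r -mulrnAr sqrtrM ?sqr_ge0//.
by rewrite sqrtr_sqr gtr0_norm// invfM mulrA divff ?gt_eqF// mul1r.
Qed.

Lemma normal_pdf_scale s x : 0 < s ->
  s * normal_pdf 0 s x = normal_peak 1 * expR (- x ^+ 2 / (s ^+ 2 *+ 2)).
Proof. by move=> s0; rewrite normal_pdf_gt0E// subr0 mulrA normal_peak_scale. Qed.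

(** This bound and the next one compare the density with a shifted or dilated
    copy by means of [1 + u <= expR u].  As all these densities have integral 1,
    integration turns them into inequalities for the first two moments, which
    determine these moments when the parameter varies. *)
Lemma le_normal_pdf_shift m x :
  normal_pdf 0 1 x * (1 + (m * x - m ^+ 2 / 2)) <= normal_pdf m 1 x.
Proof.
rewrite !normal_pdf_gt0E// -[leLHS]mulrA ler_wpM2l ?normal_peak_ge0//.
have -> : - (x - m) ^+ 2 / (1 ^+ 2 *+ 2) =
    - (x - 0) ^+ 2 / (1 ^+ 2 *+ 2) + (m * x - m ^+ 2 / 2) :> R.
  by field.
by rewrite expRD ler_wpM2l ?expR_ge0// expR_ge1Dx.
Qed.

Lemma le_normal_pdf_dilate s x : 0 < s ->
  normal_pdf 0 1 x * (1 + (1 - s ^- 2) / 2 * x ^+ 2) <= s * normal_pdf 0 s x.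
Proof.
move=> s0; rewrite normal_pdf_scale// normal_pdf_gt0E// -[leLHS]mulrA ler_wpM2l ?normal_peak_ge0//.
have -> : - x ^+ 2 / (s ^+ 2 *+ 2) =
    - (x - 0) ^+ 2 / (1 ^+ 2 *+ 2) + (1 - s ^- 2) / 2 * x ^+ 2 :> R.
  by field; rewrite gt_eqF.
by rewrite expRD ler_wpM2l ?expR_ge0// expR_ge1Dx.
Qed.

(** Domination by a wider Gaussian gives a finite fourth moment, hence the
    integrability of the lower powers and a tail estimate. *)
Lemma expr4_normal_pdf_le x : x ^+ 4 * normal_pdf 0 1 x <= 64 * normal_pdf 0 2 x.
Proof.
have -> : 64 * normal_pdf 0 2 x = 32 * (2 * normal_pdf 0 2 x) by ring.
rewrite normal_pdf_scale// normal_pdf_gt0E// [leLHS]mulrCA [leRHS]mulrCA ler_wpM2l ?normal_peak_ge0//.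
set u := x ^+ 2 * (3 / 8).
have -> : - x ^+ 2 / (2 ^+ 2 *+ 2) = - (x - 0) ^+ 2 / (1 ^+ 2 *+ 2) + u :> R.
  by rewrite /u; field.
rewrite expRD [leLHS]mulrC [leRHS]mulrCA ler_wpM2l ?expR_ge0//.
have u0 : 0 <= u by rewrite /u mulr_ge0// sqr_ge0.
have u2 : (1 + u / 2) ^+ 2 <= expR u.
  rewrite (_ : expR u = expR (u / 2) ^+ 2); last by rewrite expr2 -expRD -splitr.
  by rewrite lerXn2r ?nnegrE ?expR_ge0 ?expR_ge1Dx// addr_ge0// divr_ge0.
have xu : x ^+ 4 = u ^+ 2 * (64 / 9) by rewrite /u; field.
by rewrite xu; nra.
Qed.

Lemma integrable_pdf m s : mu.-integrable [set: R] (EFin \o normal_pdf m s).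
Proof. exact: integrable_normal_pdf. Qed.

Lemma Rintegral_pdf m s : \int[mu]_x normal_pdf m s x = 1.
Proof. by rewrite /Rintegral integral_normal_pdf. Qed.

Lemma measurable_exprn_pdf (n : nat) :
  measurable_fun [set: R] (fun x => x ^+ n * normal_pdf 0 1 x).
Proof. by apply: measurable_funM; [exact: measurable_funX|exact: measurable_normal_pdf]. Qed.

Lemma integrable_exprn_pdf (n : nat) : (n <= 4)%N ->
  mu.-integrable [set: R] (EFin \o (fun x => x ^+ n * normal_pdf 0 1 x)).
Proof.
move=> n4.
apply: (@le_integrable _ _ _ mu _ measurableT _
    (EFin \o (fun x => normal_pdf 0 1 x + 64 * normal_pdf 0 2 x))).
- by apply/measurable_EFinP; exact: measurable_exprn_pdf.
- move=> x _ /=; rewrite lee_fin normrM (ger0_norm (normal_pdf_ge0 _ _ _)).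
  apply: le_trans (ler_norm _).
  apply: le_trans (lerD (lexx _) (expr4_normal_pdf_le x)).
  rewrite -[X in X + _]mul1r -mulrDl ler_wpM2r ?normal_pdf_ge0// normrX.
  rewrite (_ : x ^+ 4 = `|x| ^+ 4); last by rewrite -normrX ger0_norm// exprn_even_ge0.
  have [x1|/ltW x1] := leP `|x| 1.
    by apply: (le_trans (exprn_ile1 _ _ x1)) => //; rewrite lerDl exprn_ge0.
  by apply: (le_trans (ler_weXn2l x1 n4)); rewrite lerDr.
- apply: (@integrableD _ _ _ mu _ measurableT (EFin \o normal_pdf 0 1)
    (fun x => (64 * normal_pdf 0 2 x)%:E)); first exact: integrable_pdf.
  by under eq_fun do rewrite EFinM; apply: integrableZl => //; exact: integrable_pdf.
Qed.

Lemma Rintegral_pdf_lin (a b : R) (n : nat) : (n <= 4)%N ->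
  mu.-integrable [set: R] (EFin \o (fun x => normal_pdf 0 1 x * (a + b * x ^+ n))) /\
  \int[mu]_x (normal_pdf 0 1 x * (a + b * x ^+ n)) =
    a + b * \int[mu]_x (x ^+ n * normal_pdf 0 1 x).
Proof.
move=> n4; have i0 := integrable_pdf 0 1; have i1 := integrable_exprn_pdf n n4.
have E : (fun x => normal_pdf 0 1 x * (a + b * x ^+ n)) =
    (fun x => a * normal_pdf 0 1 x + b * (x ^+ n * normal_pdf 0 1 x)).
  by apply/funext => x; ring.
have ia : mu.-integrable [set: R] (EFin \o (fun x => a * normal_pdf 0 1 x)).
  by rewrite /comp; under eq_fun do rewrite EFinM; exact: integrableZl.
have ib : mu.-integrable [set: R] (EFin \o (fun x => b * (x ^+ n * normal_pdf 0 1 x))).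
  by rewrite /comp; under eq_fun do rewrite EFinM; exact: integrableZl.
rewrite E; split; first exact: (@integrableD _ _ _ mu _ measurableT _ _ ia ib).
by rewrite RintegralD// !RintegralZl// Rintegral_pdf mulr1.
Qed.

Lemma Rintegral_id_pdf : \int[mu]_x (x ^+ 1 * normal_pdf 0 1 x) = 0.
Proof.
set E := Rintegral _ _ _.
have key m : m * E <= m ^+ 2 / 2.
  have [i1 e1] := Rintegral_pdf_lin (1 - m ^+ 2 / 2) m 1 isT.
  have : \int[mu]_x (normal_pdf 0 1 x * (1 - m ^+ 2 / 2 + m * x ^+ 1)) <= \int[mu]_x normal_pdf m 1 x.
    apply: le_Rintegral => //; first exact: integrable_pdf.
    move=> x _; apply: le_trans (le_normal_pdf_shift m x).
    by rewrite expr1 addrAC addrA.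
  by rewrite e1 Rintegral_pdf -/E => ?; lra.
(* m * E <= m ^+ 2 / 2 at m = E *)
have h := key E; have h' := sqr_ge0 E.
by apply/eqP; rewrite -sqrf_eq0 eq_le h' andbT; lra.
Qed.

(** The inequality [key] reads [V <= 2 * s ^+ 2 / (s + 1)] for [s > 1] and the
    reverse for [s < 1]; both sides tend to 1 as [s] tends to 1. *)
Lemma Rintegral_sqr_pdf : \int[mu]_x (x ^+ 2 * normal_pdf 0 1 x) = 1.
Proof.
set V := Rintegral _ _ _.
have key s : 0 < s -> 1 + (1 - s ^- 2) / 2 * V <= s.
  move=> s0; have [i1 e1] := Rintegral_pdf_lin 1 ((1 - s ^- 2) / 2) 2 isT.
  rewrite -e1 -[leRHS]mulr1 -[X in _ <= s * X](Rintegral_pdf 0 s) -RintegralZl//; last first.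
    exact: integrable_pdf.
  apply: le_Rintegral => //.
    rewrite /comp; under eq_fun do rewrite EFinM.
    by apply: integrableZl => //; exact: integrable_pdf.
  by move=> x _; exact: le_normal_pdf_dilate.
have key' s : 0 < s -> (s - 1) * ((s + 1) * V) <= (s - 1) * (2 * s ^+ 2).
  move=> s0; have := key _ s0.
  rewrite -(ler_pM2r (_ : 0 < 2 * s ^+ 2)) ?mulr_gt0 ?exprn_gt0//.
  rewrite [X in X <= _ -> _](_ : _ = 2 * s ^+ 2 + (s ^+ 2 - 1) * V); last by field; rewrite gt_eqF.
  by move=> h; lra.
have V0 : 0 <= V by apply: Rintegral_ge0 => x _; rewrite mulr_ge0 ?sqr_ge0 ?normal_pdf_ge0.
apply/eqP; rewrite eq_le; apply/andP; split; apply/ler_addgt0Pr => e e0.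
- have e2 : 0 < e / 2 by rewrite divr_gt0.
  have := key' _ (addr_gt0 ltr01 e2).
  rewrite (_ : 1 + e / 2 - 1 = e / 2); last by ring.
  rewrite ler_pM2l// => h.
  rewrite -(ler_pM2l (_ : 0 < 1 + e / 2 + 1)); last by lra.
  by apply: (le_trans h); nra.
- have [e1|e1] := leP 1 e; first by rewrite (le_trans e1)// lerDr.
  have s0 : 0 < 1 - e / 2 by lra.
  have := key' _ s0.
  have -> : 1 - e / 2 - 1 = - (e / 2) by ring.
  rewrite !mulNr lerN2 ler_pM2l ?divr_gt0// => h.
  rewrite -(ler_pM2l (_ : 0 < 2 - e / 2)); last by lra.
  have -> : (2 - e / 2) * (V + e) = (1 - e / 2 + 1) * V + (2 - e / 2) * e by ring.
  by nra.
Qed.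

End Gaussian.

Section GaussianAverage.
Context {R : realType}.
Local Notation mu := (@lebesgue_measure R).
Local Notation N01 := (@normal_prob R 0 1).
Implicit Types (f : R -> R) (a b c m s x y z : R).

Lemma integral_normal m s (f : R -> \bar R) : measurable_fun [set: R] f ->
  (\int[normal_prob m s]_x f x = \int[mu]_x (f x * (normal_pdf m s x)%:E))%E.
Proof.
move=> mf; rewrite integralE [RHS]integralE.
rewrite !ge0_integral_normal//; [|exact: measurable_funeneg|exact: measurable_funepos].
congr (_ - _)%E; apply: eq_integral => x _; rewrite ?funeposE ?funenegE.
  by rewrite maxe_pMl ?mul0e ?lee_fin ?normal_pdf_ge0.
by rewrite -mulNe maxe_pMl ?mul0e ?lee_fin ?normal_pdf_ge0.
Qed.

Lemma standardized_normal : standardized N01 (fun x => x).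
Proof.
have fin (n : nat) : (n <= 4)%N ->
    (\int[N01]_x (x ^+ n)%:E = (\int[mu]_x (x ^+ n * normal_pdf 0 1 x)%R)%:E)%E.
  move=> n4; rewrite /Rintegral fineK; last first.
    by apply: integrable_fin_num => //; exact: integrable_exprn_pdf.
  rewrite integral_normal; last by apply/measurable_EFinP; exact: measurable_funX.
  by apply: eq_integral => x _; rewrite EFinM.
split => //.
- by have := fin 1%N isT; rewrite Rintegral_id_pdf; under eq_integral do rewrite expr1.
- by rewrite fin// Rintegral_sqr_pdf.
Qed.

Lemma normal_tail_le (L : R) : 0 < L ->
  (\int[N01]_(x in [set x | (L < `|x|)%R]) (x ^+ 2)%:E <= (64 / L ^+ 2)%:E)%E.
Proof.
move=> L0.
have L2 : 0 < L ^+ 2 by rewrite exprn_gt0.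
have mD : measurable [set x : R | L < `|x|] by exact: measurable_norm_gt.
have mX n : measurable_fun [set: R] (fun x => (x ^+ n)%:E).
  by apply/measurable_EFinP; exact: measurable_funX.
have mR : measurable_fun [set: R] ((fun x : R => (x ^+ 2)%:E) \_ [set x | L < `|x|]).
  exact: (measurable_restrictT (fun x : R => (x ^+ 2)%:E) mD).1 (measurable_funTS (mX 2%N)).
rewrite integral_mkcond.
apply: (@le_trans _ _ (\int[N01]_x ((L ^- 2)%:E * (x ^+ 4)%:E))%E).
  apply: ge0_le_integral => //.
  - by move=> x _; rewrite patchE; case: ifP => // _; rewrite lee_fin sqr_ge0.
  - by apply: emeasurable_funM => //; exact: mX.
  - move=> x _; rewrite patchE -EFinM; case: ifPn => [|_]; last first.
      by rewrite lee_fin mulr_ge0 ?invr_ge0 ?exprn_even_ge0// ltW.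
    rewrite inE /= => Lx; rewrite lee_fin mulrC ler_pdivlMr//.
    rewrite [leRHS](_ : _ = x ^+ 2 * x ^+ 2); last by rewrite -exprD.
    rewrite ler_wpM2l ?sqr_ge0//.
    by rewrite -(real_normK (num_real x)) lerXn2r ?nnegrE ?ltW// (lt_trans L0).
rewrite ge0_integralZl//; last 3 first.
- exact: mX.
- by move=> x _; rewrite lee_fin exprn_even_ge0.
- by rewrite lee_fin invr_ge0 ltW.
rewrite mulrC EFinM; apply: lee_wpmul2l.
  by rewrite lee_fin invr_ge0 ltW.
rewrite integral_normal//.
have -> : 64%:E = (\int[mu]_x (64 * normal_pdf 0 2 x)%:E)%E :> \bar R.
  under eq_integral do rewrite EFinM.
  by rewrite integralZl ?integral_normal_pdf ?mule1//; exact: integrable_normal_pdf.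
apply: ge0_le_integral => //.
- by move=> x _; rewrite -EFinM lee_fin mulr_ge0 ?normal_pdf_ge0 ?exprn_even_ge0.
- under eq_fun do rewrite -EFinM.
  by apply/measurable_EFinP; exact: measurable_exprn_pdf.
- by apply/measurable_EFinP; apply: measurable_funM => //; exact: measurable_normal_pdf.
- by move=> x _; rewrite -EFinM lee_fin expr4_normal_pdf_le.
Qed.

Lemma normal_pdf_affine x c y : 0 < c ->
  normal_pdf x c (x + c * y) * c = normal_pdf 0 1 y.
Proof.
move=> c0; rewrite !normal_pdf_gt0E// mulrAC (mulrC _ c) normal_peak_scale//.
by congr (_ * expR _); field; rewrite gt_eqF.
Qed.

(** The change of variables [z = x + c * y]. *)
Lemma integral_normal_affine f x c : 0 < c -> continuous f -> (forall z, 0 <= f z) ->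
  (\int[N01]_y (f (x + c * y))%:E = \int[mu]_z (f z * normal_pdf x c z)%:E)%E.
Proof.
move=> c0 cf f0.
have mf := continuous_measurable_fun cf.
have mfc : measurable_fun [set: R] (fun y => (f (x + c * y))%:E).
  apply/measurable_EFinP; apply: measurableT_comp => //.
  by apply: measurable_funD => //; exact: measurable_funM.
have fc0 y : (0 <= (f (x + c * y))%:E)%E by rewrite lee_fin.
rewrite (ge0_integral_normal 0 1 _ mfc fc0).
pose F (y : R^o) : R^o := x + c * y.
have dF y : is_derive y 1 F c.
  have := is_deriveD (is_derive_cst (x : R^o) (y : R^o) 1)
    (is_deriveZ c (is_derive_id (y : R^o) 1)).
  by rewrite add0r /GRing.scale /= mulr1.
have F'E : F^`()%classic = cst c.
  by apply/funext => y; rewrite derive1E; apply: derive_val.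
have FE : F = (fun y => c * (y + x / c)).
  by apply/funext => y; rewrite /F; field; rewrite gt_eqF.
rewrite (@increasing_ge0_integration_by_substitutionT R F (fun z => f z * normal_pdf x c z)).
- apply: eq_integral => y _; rewrite F'E /= -EFinM; congr (_%:E).
  by rewrite /F -(normal_pdf_affine x c y c0) mulrA.
- by move=> y z yz; rewrite /F ltrD2l ltr_pM2l.
- by rewrite F'E => ?; exact: cvg_cst.
- by rewrite F'E; exact: is_cvg_cst.
- by rewrite F'E; exact: is_cvg_cst.
- by move=> y; apply: ex_derive.
- by rewrite FE; apply/gt0_cvgMrNy => //; exact: cvg_addrr_Ny.
- by rewrite FE; apply/gt0_cvgMry => //; exact: cvg_addrr.
- move=> z; apply: cvgM; [exact: cf|].
  by apply: continuous_normal_pdf; rewrite gt_eqF.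
- by move=> z; rewrite mulr_ge0// normal_pdf_ge0.
Qed.

(** Completing the square in [y]: the product of the two densities is the
    density in [z] of the convolution, times a probability density in [y]. *)
Lemma normal_pdf_mul a b y z : 0 < a -> 0 < b ->
  let s := Num.sqrt (a ^+ 2 + b ^+ 2) in
  normal_pdf y b z * normal_pdf 0 a y =
  normal_pdf 0 s z * normal_pdf (z * a ^+ 2 / s ^+ 2) (a * b / s) y.
Proof.
move=> a0 b0 s.
have ab0 : 0 < a ^+ 2 + b ^+ 2 by rewrite addr_gt0 ?exprn_gt0.
have s0 : 0 < s by rewrite sqrtr_gt0.
have s2 : s ^+ 2 = a ^+ 2 + b ^+ 2 by rewrite sqr_sqrtr// ltW.
have t0 : 0 < a * b / s by rewrite divr_gt0 ?mulr_gt0.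
rewrite !normal_pdf_gt0E//.
rewrite mulrACA [RHS]mulrACA; congr (_ * _).
  have pE c : 0 < c -> normal_peak c = normal_peak 1 / c.
    by move=> c0; rewrite -(normal_peak_scale _ c0) mulrC mulKf// gt_eqF.
  rewrite (pE _ a0) (pE _ b0) (pE _ s0) (pE _ t0).
  by field; rewrite !gt_eqF.
rewrite -!expRD; congr expR; rewrite exprMn exprVn exprMn s2.
by field; rewrite !gt_eqF ?exprn_gt0.
Qed.

End GaussianAverage.

Section GaussianSemigroup.
Context {R : realType}.
Local Notation mu := (@lebesgue_measure R).
Local Notation N01 := (@normal_prob R 0 1).
Implicit Types (f : R -> R) (M a b u v x y z : R).

(** The heat semigroup, [v] being the variance. *)
Definition gauss_average v f x : R := average N01 (fun y => Num.sqrt v * y) f x.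

Lemma measurable_scale (c : R) :
  measurable_fun [set: measurableTypeR R] (fun y : R => c * y).
Proof. exact: measurable_funM. Qed.

Lemma smooth_test_gauss_average M v f : smooth_test M f -> smooth_test M (gauss_average v f).
Proof. by move=> fS; apply: smooth_test_average => //; exact: measurable_scale. Qed.

Lemma gauss_average0 f x : gauss_average 0 f x = f x.
Proof.
rewrite /gauss_average /average sqrtr0.
under eq_Rintegral do rewrite mul0r addr0.
exact: Rintegral_cstT.
Qed.

Lemma smooth_test_bl M f : smooth_test M f -> bounded_lipschitz M f.
Proof. by move=> [_ [f1 [f2 []]]]. Qed.

Lemma smooth_test_continuous M f : smooth_test M f -> continuous f.
Proof. by move=> /smooth_test_bl; exact: bounded_lipschitz_continuous. Qed.

Lemma EFin_gauss_average M v f x : smooth_test M f -> 0 < v ->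
  (gauss_average v f x)%:E = (\int[mu]_z (f z * normal_pdf x (Num.sqrt v) z)%:E)%E.
Proof.
move=> fS v0; rewrite /gauss_average /average /Rintegral fineK; last first.
  apply: integrable_fin_num => //; apply: (integrable_bl_shift _ M).
    exact: measurable_scale.
  exact: smooth_test_bl.
apply: integral_normal_affine; first by rewrite sqrtr_gt0.
  exact: smooth_test_continuous fS.
exact: fS.1.
Qed.

Lemma measurable_normal_product f a b : measurable_fun [set: R] f -> 0 < b ->
  measurable_fun [set: measurableTypeR R * measurableTypeR R]
    (fun p => (f p.2 * normal_pdf p.1 b p.2 * normal_pdf 0 a p.1)%:E).
Proof.
move=> mf b0; apply/measurable_EFinP; apply: measurable_funM; last first.
  by apply: measurableT_comp => //; exact: measurable_normal_pdf.
apply: measurable_funM; first exact: measurableT_comp.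
under eq_fun do rewrite normal_pdf_gt0E//.
apply: measurable_funM => //; apply: measurableT_comp => //.
apply: measurable_funM => //; apply: measurableT_comp => //.
by apply: measurable_funX; exact: measurable_funB.
Qed.

(** The convolution identity for normal laws, at the origin and for test
    functions: exchange the two integrations by Tonelli, then integrate out the
    intermediate point with [normal_pdf_mul]. *)
Lemma gauss_averageD M u v f : smooth_test M f -> 0 <= u -> 0 <= v ->
  gauss_average u (gauss_average v f) 0 = gauss_average (u + v) f 0.
Proof.
move=> fS; rewrite le_eqVlt => /predU1P[<- _|u0].
  by rewrite add0r gauss_average0.
rewrite le_eqVlt => /predU1P[<-|v0].
  rewrite addr0 /gauss_average /average; apply: eq_Rintegral => y _.
  exact: gauss_average0.
have uv0 : 0 < u + v by rewrite addr_gt0.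
set a := Num.sqrt u; set b := Num.sqrt v.
have a0 : 0 < a by rewrite sqrtr_gt0.
have b0 : 0 < b by rewrite sqrtr_gt0.
have sE : Num.sqrt (u + v) = Num.sqrt (a ^+ 2 + b ^+ 2) by rewrite !sqr_sqrtr ?ltW.
have f0 := fS.1.
have mf := continuous_measurable_fun (smooth_test_continuous _ _ fS).
apply: EFin_inj.
rewrite (EFin_gauss_average M)//; last exact: smooth_test_gauss_average.
rewrite (EFin_gauss_average M _ _ _ fS uv0).
transitivity (\int[mu]_y \int[mu]_z (f z * normal_pdf y b z * normal_pdf 0 a y)%:E)%E.
  apply: eq_integral => y _; rewrite EFinM (EFin_gauss_average M)//.
  rewrite -ge0_integralZr//; last 3 first.
  - apply/measurable_EFinP; apply: measurable_funM => //; exact: measurable_normal_pdf.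
  - by move=> z _; rewrite lee_fin mulr_ge0 ?normal_pdf_ge0.
  - by rewrite lee_fin normal_pdf_ge0.
rewrite (@fubini_tonelli _ _ _ _ _ mu mu
  (fun p => (f p.2 * normal_pdf p.1 b p.2 * normal_pdf 0 a p.1)%:E)); last 2 first.
- exact: measurable_normal_product.
- by move=> p; rewrite lee_fin !mulr_ge0 ?normal_pdf_ge0.
apply: eq_integral => z _ /=.
under eq_integral do rewrite -mulrA normal_pdf_mul// -sE mulrA EFinM.
rewrite ge0_integralZl//; last 3 first.
- by apply/measurable_EFinP; exact: measurable_normal_pdf.
- by move=> y _; rewrite lee_fin normal_pdf_ge0.
- by rewrite lee_fin mulr_ge0 ?normal_pdf_ge0.
by rewrite integral_normal_pdf mule1.
Qed.

End GaussianSemigroup.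

(** * Independence of weighted sums *)

Section EventLaw.
Context {d d'} {T : measurableType d} {T' : measurableType d'} {R : realType}.
Variables (P : probability T R) (E : set T) (Y : {mfun T >-> T'}).

(** The law of [Y] on the event [E].  The proof of measurability of [E] is an
    argument so that the measure structure can be inferred from the term. *)
Definition event_law of measurable E := fun A : set T' => P (Y @^-1` A `&` E).

Hypothesis mE : measurable E.

Let mpre A : measurable A -> measurable (Y @^-1` A `&` E).
Proof. by move=> mA; apply: measurableI => //; exact: measurable_funPTI. Qed.

Let event_law0 : (event_law mE) set0 = 0%E.
Proof. by rewrite /event_law preimage_set0 set0I measure0. Qed.

Let event_law_ge0 A : (0 <= event_law mE A)%E.
Proof. exact: measure_ge0. Qed.

Let event_law_sigma_additive : semi_sigma_additive (event_law mE).
Proof.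
move=> F mF tF mUF; rewrite /event_law preimage_bigcup setI_bigcupl.
apply: measure_semi_sigma_additive.
- by move=> n; exact: mpre.
- apply/trivIsetP => i j _ _ ij; rewrite setIACA setIid -preimage_setI.
  by move/trivIsetP : tF => /(_ _ _ _ _ ij) ->//; rewrite preimage_set0 set0I.
- by rewrite -setI_bigcupl -preimage_bigcup; exact: mpre.
Qed.

HB.instance Definition _ := isMeasure.Build _ _ _ (event_law mE)
  event_law0 event_law_ge0 event_law_sigma_additive.

Let event_law_fin : fin_num_fun (event_law mE).
Proof. by move=> A mA; apply: fin_num_measure; exact: mpre. Qed.

HB.instance Definition _ := Measure_isFinite.Build _ _ _ (event_law mE) event_law_fin.

End EventLaw.
Arguments event_law {d d' T T' R} P {E} Y.

Section Independence.
Context {d} {T : measurableType d} {R : realType} (P : probability T R).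
Implicit Types (X Y : {RV P >-> R}).

Definition independent_pair X Y : Prop := forall A B, measurable A -> measurable B ->
  P (X @^-1` A `&` Y @^-1` B) = (P (X @^-1` A) * P (Y @^-1` B))%E.

Definition pairRV X Y (w : T) : R * R := (X w, Y w).

Lemma measurable_pairRV X Y : measurable_fun [set: T] (pairRV X Y).
Proof. exact: measurable_fun_pair. Qed.

HB.instance Definition _ X Y :=
  isMeasurableFun.Build _ _ _ _ (pairRV X Y) (measurable_pairRV X Y).

(** Two finite measures on the plane that agree on rectangles are equal. *)
Lemma independent_pair_law X Y : independent_pair X Y -> forall D, measurable D ->
  (distribution P X \x distribution P Y)%E D = P (pairRV X Y @^-1` D).
Proof.
move=> indep D mD.
by rewrite (@product_measure_unique _ _ _ _ _ (distribution P X) (distribution P Y)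
  (distribution P (pairRV X Y))).
Qed.

(** Independence of [E] from the rectangles generated by the pair [(X, Y)] extends
    to all events generated by the pair: both sides are, as functions of [D],
    finite measures on the plane with the same values on rectangles. *)
Lemma independent_pair_event (E : set T) X Y : measurable E ->
  independent_pair X Y ->
  (forall A B, measurable A -> measurable B ->
    P ((X @^-1` A `&` Y @^-1` B) `&` E) = (P (X @^-1` A) * P (Y @^-1` B) * P E)%E) ->
  forall D, measurable D ->
    P (pairRV X Y @^-1` D `&` E) = (P (pairRV X Y @^-1` D) * P E)%E.
Proof.
move=> mE XY XYE D mD.
have PEfin : P E \is a fin_num by exact: fin_num_measure.
have p0 : 0 <= fine (P E) by exact: fine_ge0.
pose p : {nonneg R} := NngNum p0.
have XE A : measurable A -> P (X @^-1` A `&` E) = (P (X @^-1` A) * P E)%E.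
  move=> mA; have := XYE A [set: R] mA measurableT.
  by rewrite preimage_setT setIT (probability_setT P) mule1.
have u1 := @product_measure_unique _ _ _ _ _ (event_law P X mE) (distribution P Y)
  (event_law P (pairRV X Y) mE).
have u2 := @product_measure_unique _ _ _ _ _ (event_law P X mE) (distribution P Y)
  (mscale p (distribution P (pairRV X Y))).
transitivity ((event_law P X mE \x distribution P Y)%E D).
  rewrite u1// => A B mA mB.
  change (P ((X @^-1` A `&` Y @^-1` B) `&` E) = (P (X @^-1` A `&` E) * P (Y @^-1` B))%E).
  by rewrite XYE// XE// muleAC.
have pE : (p%:num)%:E = P E by rewrite /= fineK.
rewrite u2//.
  by rewrite [RHS]muleC; congr (_ * _)%E.
move=> A B mA mB; transitivity (P E * P (X @^-1` A `&` Y @^-1` B))%E.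
  by congr (_ * _)%E.
change (P E * P (X @^-1` A `&` Y @^-1` B) = P (X @^-1` A `&` E) * P (Y @^-1` B))%E.
by rewrite XY// XE// muleA [X in (X * _)%E = _]muleC.
Qed.

Context {I : choiceType} (xi : I -> {RV P >-> R}) (c : I -> R).
Implicit Types (s : seq I) (J : {fset I}) (B : I -> set R).

Definition wsum s (w : T) : R := \sum_(i <- s) c i * xi i w.

Lemma measurable_wsum s : measurable_fun [set: T] (wsum s).
Proof.
elim: s => [|i s IH].
  by rewrite (_ : wsum [::] = cst 0)//; apply/funext => w; rewrite /wsum big_nil.
rewrite (_ : wsum (i :: s) = (fun w => c i * xi i w + wsum s w)); last first.
  by apply/funext => w; rewrite /wsum big_cons.
by apply: measurable_funD => //; exact: measurable_funM.
Qed.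

HB.instance Definition _ s :=
  isMeasurableFun.Build _ _ _ _ (wsum s) (measurable_wsum s).

Let evt J B := \bigcap_(j in [set` J]) (xi j @^-1` B j).

Let measurable_evt J B : (forall j, j \in J -> measurable (B j)) -> measurable (evt J B).
Proof.
move=> mB; apply: fin_bigcap_measurable; first exact: finite_fset.
by move=> j jJ; apply: measurable_funPTI => //; exact: mB.
Qed.

Let evt_fset1 i (C : set R) : evt [fset i]%fset (fun=> C) = xi i @^-1` C.
Proof.
apply/seteqP; split=> [w h|w h j /=]; first by apply: (h i); rewrite /= inE.
by rewrite inE => /eqP ->.
Qed.

Hypothesis xi_indep : mutually_independent xi.

(** Induction on [s].  The event on the innovations outside [s] is arbitrary, for
    the induction hypothesis is used with [xi i] added to it. *)
Lemma wsum_independent s J B A : uniq s -> (forall i, i \in s -> i \notin J) ->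
  (forall j, j \in J -> measurable (B j)) -> measurable A ->
  P (wsum s @^-1` A `&` evt J B) = (P (wsum s @^-1` A) * P (evt J B))%E.
Proof.
elim: s J B A => [|i s IH] J B A /=.
  move=> _ _ mB mA; have [A0|A0] := pselect (A 0).
    rewrite (_ : wsum [::] @^-1` A = [set: T]) ?setTI ?(probability_setT P) ?mul1e//.
    by apply/seteqP; split=> w //= _; rewrite /wsum big_nil.
  rewrite (_ : wsum [::] @^-1` A = set0) ?set0I ?measure0 ?mul0e//.
  by apply/seteqP; split=> w //=; rewrite /wsum big_nil.
move=> /andP[is_ us] sJ mB mA.
have iJ : i \notin J by apply: sJ; rewrite inE eqxx.
have evtE C : xi i @^-1` C `&` evt J B =
    evt (i |` J)%fset (fun j => if j == i then C else B j).
  apply/seteqP; split=> [w [Cw Jw] j /=|w Jw].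
    by rewrite in_fset1U => /predU1P[->|jJ]; rewrite ?eqxx//; case: eqP => [->//|_]; exact: Jw.
  split; first by have := Jw i; rewrite /= eqxx; apply; rewrite in_fset1U eqxx.
  move=> j jJ; have := Jw j; rewrite /= ifN; first by apply; rewrite in_fset1U jJ orbT.
  by apply: contraNneq iJ => <-.
have mBC C : measurable C -> forall j, j \in (i |` J)%fset ->
    measurable (if j == i then C else B j).
  by move=> mC j; rewrite in_fset1U; case: eqP => //= _ jJ; exact: mB.
have PevtE C : measurable C ->
    P (xi i @^-1` C `&` evt J B) = (P (xi i @^-1` C) * P (evt J B))%E.
  move=> mC; rewrite evtE xi_indep; last exact: mBC.
  rewrite big_fsetU1//= eqxx; congr (_ * _)%E; rewrite xi_indep//.
  rewrite big_seq [RHS]big_seq; apply: eq_bigr => j jJ.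
  by rewrite ifN//; apply: contraNneq iJ => <-.
have sJ' : forall k, k \in s -> k \notin J by move=> k ks; apply: sJ; rewrite inE ks orbT.
have siJ : forall k, k \in s -> k \notin (i |` J)%fset.
  by move=> k ks; rewrite in_fset1U negb_or sJ'// andbT; apply: contraNneq is_ => <-.
have XY : independent_pair (wsum s) (xi i).
  move=> C1 C2 mC1 mC2.
  have := IH [fset i]%fset (fun=> C2) C1 us; rewrite evt_fset1.
  by apply => // k ks; rewrite inE; apply: contraNneq is_ => <-.
pose g (p : R * R) := c i * p.2 + p.1.
have mg : measurable_fun [set: R * R] g.
  by apply: measurable_funD => //; exact: measurable_funM.
have -> : wsum (i :: s) @^-1` A = pairRV (wsum s) (xi i) @^-1` (g @^-1` A).
  by apply/seteqP; split=> w; rewrite /= /wsum big_cons.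
apply: independent_pair_event => //.
- exact: measurable_evt.
- move=> C1 C2 mC1 mC2; rewrite -setIA evtE IH//; last exact: mBC.
  by rewrite -evtE PevtE// muleA.
- by rewrite -[X in measurable X]setTI; exact: mg.
Qed.

Lemma wsum_independent_pair i s : uniq (i :: s) -> independent_pair (wsum s) (xi i).
Proof.
move=> /= /andP[is_ us] C1 C2 mC1 mC2.
have := @wsum_independent s [fset i]%fset (fun=> C2) C1 us; rewrite evt_fset1.
by apply => // k ks; rewrite inE; apply: contraNneq is_ => <-.
Qed.

End Independence.

(** * Lindeberg replacement *)

Section Lindeberg.
Context {d} {T : measurableType d} {R : realType} (P : probability T R).
Implicit Types (X Y : {RV P >-> R}) (f : R -> R) (M : R).
Local Notation N01 := (@normal_prob R 0 1).

(** Fubini: integrate over [X] first, [Y] being frozen. *)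
Lemma independent_pair_average M f X Y (c : R) : smooth_test M f ->
  independent_pair P Y X ->
  \int[P]_w f (Y w + c * X w) = \int[P]_w average P (fun w' => c * X w') f (Y w).
Proof.
move=> fS YX.
have fB := smooth_test_bl _ _ fS; have f0 := fS.1.
have mf := bounded_lipschitz_measurable _ _ fB.
have mcX : measurable_fun [set: T] (fun w => c * X w) by exact: measurable_funM.
pose h (p : R * R) : \bar R := (f (p.1 + c * p.2))%:E.
have mh : measurable_fun [set: R * R] h.
  apply/measurable_EFinP; apply: measurableT_comp => //.
  by apply: measurable_funD => //; exact: measurable_funM.
have h0 p : (0 <= h p)%E by rewrite lee_fin.
congr fine; transitivity (\int[P]_w h (pairRV P Y X w))%E; first by [].
rewrite -(ge0_integral_distribution (pairRV P Y X : {RV P >-> (R * R)%type}) mh h0).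
transitivity (\int[distribution P Y \x distribution P X]_p h p)%E.
  by apply: eq_measure_integral => D mD _; apply/esym; exact: (independent_pair_law P Y X YX).
rewrite fubini_tonelli1// ge0_integral_distribution//; last 2 first.
- exact: measurable_fun_fubini_tonelli_F.
- by move=> y; apply: integral_ge0.
apply: eq_integral => w _ /=; rewrite /fubini_F ge0_integral_distribution//.
  rewrite /average /Rintegral fineK//.
  apply: integrable_fin_num => //.
  exact: (integrable_bl_shift P M (fun w => c * X w) f (Y w) mcX fB).
have m : measurable_fun [set: R] (fun y : R => Y w + c * y).
  by apply: measurable_funD => //; exact: measurable_funM.
by apply/measurable_EFinP; exact: (measurableT_comp mf m).
Qed.

Context {I : choiceType} (xi : I -> {RV P >-> R}) (c : I -> R).
Hypotheses (xi_indep : mutually_independent xi)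
  (xi_std : forall i, standardized P (xi i)).
Variables (L eta rho : R).
Hypotheses (L0 : 0 <= L)
  (xi_tail : forall i,
    (\int[P]_(w in [set w | (L < `|xi i w|)%R]) (xi i w ^+ 2)%:E <= eta%:E)%E)
  (normal_tail : (\int[N01]_(x in [set x : measurableTypeR R | (L < `|x|)%R])
    (x ^+ 2)%:E <= eta%:E)%E).

(** Both averages have the same second order expansion, since [Num.sqrt (b ^+ 2)]
    and [b] have the same square. *)
Lemma replacement_le M f (b x : R) i : smooth_test M f -> `|b| <= rho ->
  `|average P (fun w => b * xi i w) f x - gauss_average (b ^+ 2) f x|
   <= 2 * M * (eta + rho * L) * b ^+ 2.
Proof.
move=> [f0 [f1 [f2 [fM _ _ fT]]]] brho.
have M0 : 0 <= M by apply: le_trans (fM.1 0).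
have h1 := average_taylor2 P M (xi i) f f1 f2 L eta b x (xi_std i) L0 (xi_tail i) fM fT.
have := average_taylor2 N01 M _ f f1 f2 L eta (Num.sqrt (b ^+ 2)) x
  standardized_normal L0 normal_tail fM fT.
rewrite -/(gauss_average _ f x) sqr_sqrtr ?sqr_ge0// sqrtr_sqr normr_id => h2.
set u := average _ _ _ _ in h1 *; set v := gauss_average _ _ _ in h2 *.
set t := f x + _ in h1 h2.
have -> : u - v = (u - t) - (v - t) by ring.
apply: (le_trans (ler_normB _ _)); apply: (le_trans (lerD h1 h2)).
have k : b ^+ 2 * eta + `|b| ^+ 3 * L <= (eta + rho * L) * b ^+ 2.
  rewrite mulrDl (mulrC eta) lerD2l -(real_normK (num_real b)) exprS mulrAC.
  by rewrite ler_wpM2r ?exprn_ge0// ler_wpM2r.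
by have := ler_wpM2l M0 k; lra.
Qed.

(** The summand [c i * xi i] is integrated out first, which replaces [f] by an
    average of [f]; up to the error of [replacement_le] this is a Gaussian average
    of [f], to which the induction hypothesis applies because it is a test
    function with the same constant. *)
Lemma lindeberg_replacement M f s : smooth_test M f -> uniq s ->
  (forall i, i \in s -> `|c i| <= rho) ->
  `|\int[P]_w f (wsum P xi c s w) - gauss_average (\sum_(i <- s) c i ^+ 2) f 0|
   <= 2 * M * (eta + rho * L) * \sum_(i <- s) c i ^+ 2.
Proof.
elim: s f => [|i s IH] f fS.
  move=> _ _; rewrite !big_nil gauss_average0 mulr0.
  rewrite (_ : (fun w => _) = (fun=> f 0)) ?Rintegral_cstT ?subrr ?normr0//.
  by apply/funext => w; rewrite /wsum big_nil.
move=> us crho; have crhoi : `|c i| <= rho by apply: crho; rewrite inE eqxx.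
have us' : uniq s by case/andP: us.
pose g := gauss_average (c i ^+ 2) f.
have gS : smooth_test M g by exact: smooth_test_gauss_average.
have crho' k : k \in s -> `|c k| <= rho by move=> ks; apply: crho; rewrite inE ks orbT.
have {}IH := IH g gS us' crho'.
have v0 : 0 <= \sum_(k <- s) c k ^+ 2 by apply: sumr_ge0 => k _; exact: sqr_ge0.
rewrite (gauss_averageD M) in IH; [|exact: fS|exact: v0|exact: sqr_ge0].
rewrite big_cons (addrC (c i ^+ 2)) mulrDr.
set U := gauss_average _ f 0 in IH *.
have -> : \int[P]_w f (wsum P xi c (i :: s) w) =
    \int[P]_w average P (fun w' => c i * xi i w') f (wsum P xi c s w).
  rewrite -(independent_pair_average M f (xi i) (wsum P xi c s) (c i) fS); last first.
    exact: wsum_independent_pair.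
  by apply: eq_Rintegral => w _; rewrite /wsum big_cons addrC.
set a := average P _ f.
have aS : smooth_test M a by apply: smooth_test_average => //; exact: measurable_funM.
have mW := measurable_wsum P xi c s.
have ma h : smooth_test M h -> measurable_fun [set: T] (fun w => h (wsum P xi c s w)).
  move=> hS; apply: measurableT_comp => //.
  exact: (bounded_lipschitz_measurable _ _ (smooth_test_bl _ _ hS)).
have ia h : smooth_test M h -> P.-integrable [set: T] (EFin \o (fun w => h (wsum P xi c s w))).
  move=> hS; apply: (bounded_integrable P M); first exact: ma.
  by move=> w; exact: (smooth_test_bl _ _ hS).1.
have -> : \int[P]_w a (wsum P xi c s w) - U =
    (\int[P]_w g (wsum P xi c s w) - U) + \int[P]_w (a (wsum P xi c s w) - g (wsum P xi c s w)).
  rewrite RintegralB//; [by ring|exact: ia|exact: ia].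
apply: (le_trans (ler_normD _ _)); apply: lerD => //.
apply: normr_Rintegral_le; first by apply: measurable_funB; exact: ma.
by move=> w; exact: replacement_le.
Qed.

End Lindeberg.

(** * From distribution functions to laws *)

Section LawOfCdf.
Context {d} {T : measurableType d} {R : realType} (P : probability T R).
Variables (F : distribution_function R) (X : {RV P >-> R}).
Hypothesis cdfX : forall z, cdf X z = (F z)%:E.

(** The Lebesgue-Stieltjes measures live on [measurableTypeR R], whose measurable
    sets are those of [R] but which is a different measurable type. *)
Definition borelRV (Y : {RV P >-> R}) (w : T) : measurableTypeR R := Y w.

Let measurable_borelRV : measurable_fun [set: T] (borelRV X).
Proof. exact: (@measurable_funPT _ _ _ _ X). Qed.

HB.instance Definition _ := isMeasurableFun.Build _ _ _ _ (borelRV X) measurable_borelRV.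

Lemma lebesgue_stieltjes_distribution A : measurable A ->
  lebesgue_stieltjes_measure F A = distribution P (borelRV X) A.
Proof.
apply: lebesgue_stieltjes_measure_unique => _ [[a b]]/= _ <-.
rewrite /lebesgue_stieltjes_measure /measure_extension/=.
rewrite measurable_mu_extE/=; last exact: is_ocitv.
have [ab | ba] := leP a b; last first.
  by rewrite set_itv_ge ?wlength0 ?measure0// bnd_simp -leNgt ltW.
rewrite wlength_itv_bnd// EFinB -!cdfX /cdf.
have : `]a, b]%classic = `]-oo, b] `\` `]-oo, a] => [|->].
  by rewrite -[RHS]setCK setCD setCitvl setUC -[LHS]setCK setCitv.
change (P (X @^-1` `]-oo, b]) - P (X @^-1` `]-oo, a]) =
  P (X @^-1` `]-oo, b] `\` X @^-1` `]-oo, a]))%E.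
rewrite measureD.
- by congr (_ - P _)%E; rewrite setIidr//; apply: preimage_subset; exact: subset_itvl.
- exact: measurable_funPTI.
- exact: measurable_funPTI.
- by rewrite -ge0_fin_numE// fin_num_measure//; exact: measurable_funPTI.
Qed.

Lemma ge0_integral_lebesgue_stieltjes (f : R -> \bar R) :
  measurable_fun [set: R] f -> (forall y, 0 <= f y)%E ->
  (\int[lebesgue_stieltjes_measure F]_x f x = \int[P]_w f (X w))%E.
Proof.
move=> mf f0.
transitivity (\int[distribution P (borelRV X)]_x f x)%E.
  by apply: eq_measure_integral => A mA _; exact: lebesgue_stieltjes_distribution.
exact: ge0_integral_distribution.
Qed.

(** Integrable or not, [f] has its positive and negative parts transported
    separately. *)
Lemma integral_lebesgue_stieltjes (f : R -> \bar R) : measurable_fun [set: R] f ->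
  (\int[lebesgue_stieltjes_measure F]_x f x = \int[P]_w f (X w))%E.
Proof.
move=> mf; rewrite integralE [RHS]integralE.
congr (_ - _)%E.
  rewrite ge0_integral_lebesgue_stieltjes; [|exact: measurable_funepos|by []].
  by apply: eq_integral => w _; rewrite !funeposE.
rewrite ge0_integral_lebesgue_stieltjes; [|exact: measurable_funeneg|by []].
by apply: eq_integral => w _; rewrite !funenegE.
Qed.

Lemma standardized_of_cdf :
  (\int[lebesgue_stieltjes_measure F]_x x%:E = 0)%E ->
  (\int[lebesgue_stieltjes_measure F]_x (x ^+ 2)%:E = 1)%E -> standardized P X.
Proof.
move=> F1 F2; split=> //.
  by rewrite -F1 (integral_lebesgue_stieltjes EFin).
rewrite -F2 (integral_lebesgue_stieltjes (fun x => (x ^+ 2)%:E))//.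
by apply/measurable_EFinP; exact: measurable_funX.
Qed.

Lemma tail_of_cdf (L : R) :
  (\int[lebesgue_stieltjes_measure F]_(x in [set x : R | (L < `|x|)%R]) (x ^+ 2)%:E =
   \int[P]_(w in [set w | (L < `|X w|)%R]) (X w ^+ 2)%:E)%E.
Proof.
have mD : measurable [set x : R | L < `|x|] by exact: measurable_norm_gt.
have mX : measurable_fun [set: R] (fun x => (x ^+ 2)%:E).
  by apply/measurable_EFinP; exact: measurable_funX.
have mR := (measurable_restrictT (fun x : R => (x ^+ 2)%:E) mD).1 (measurable_funTS mX).
by rewrite integral_mkcond [RHS]integral_mkcond integral_lebesgue_stieltjes.
Qed.

End LawOfCdf.

(** * Reduction to finite sums *)

Section FieldSums.
Context {d} {T : measurableType d} {R : realType} (P : probability T R).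
Variables (a : ZZ -> R) (xi X : ZZ -> {RV P >-> R}) (Gamma : {fset ZZ}).
Local Open Scope fset_scope.

(** Integrate [`|y| <= theta + y ^+ 2 / theta]. *)
Lemma integral_norm_le_of_sqr (Y : T -> R) (theta : R) : measurable_fun [set: T] Y ->
  0 < theta -> ('E_P[fun w => (Y w ^+ 2)%R] <= (theta ^+ 2)%:E)%E ->
  (\int[P]_w `|Y w|%:E <= (2 * theta)%:E)%E.
Proof.
move=> mY t0; rewrite unlock => EY.
have mY2 : measurable_fun [set: T] (fun w => (Y w ^+ 2)%:E).
  by apply/measurable_EFinP; exact: measurable_funX.
apply: (@le_trans _ _ (\int[P]_w (theta%:E + (theta^-1)%:E * (Y w ^+ 2)%:E))%E).
  apply: ge0_le_integral => //.
  - by apply/measurable_EFinP; exact: measurableT_comp.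
  - by apply: emeasurable_funD => //; exact: emeasurable_funM.
  - move=> w _; rewrite -EFinM -EFinD lee_fin -(ler_pM2l t0) mulrDr mulVKf ?gt_eqF//.
    rewrite -(real_normK (num_real (Y w))).
    by have := sqr_ge0 (theta - `|Y w|); have := sqr_ge0 (theta + `|Y w|); nra.
rewrite ge0_integralD//; last 3 first.
- by move=> w _; rewrite lee_fin ltW.
- by move=> w _; rewrite -EFinM lee_fin mulr_ge0 ?sqr_ge0 ?invr_ge0 ?ltW.
- exact: emeasurable_funM.
rewrite ge0_integralZl//; last 2 first.
- by move=> w _; rewrite lee_fin sqr_ge0.
- by rewrite lee_fin invr_ge0 ltW.
have /= PT := probability_setT P; rewrite integral_cst//= PT mule1.
have -> : (2 * theta)%:E = (theta%:E + (theta^-1)%:E * (theta ^+ 2)%:E)%E.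
  by rewrite -EFinM -EFinD; congr (_%:E); field; rewrite gt_eqF.
by rewrite leeD2l// lee_wpmul2l// lee_fin invr_ge0 ltW.
Qed.

(** Each [X jk] is an infinite sum over [rs] of [a rs * xi (jk - rs)]; putting
    [rs = jk + v] makes the innovation [xi (- v)] independent of [jk], and the
    finite set of indices [v] is taken large enough for all [jk] in [Gamma]. *)
Lemma Ssum_approx (tau : R) : linear_random_field a xi X -> 0 < tau ->
  exists A0 : {fset ZZ}, forall A : {fset ZZ}, A0 `<=` A ->
  (\int[P]_w `|Ssum X Gamma w - \sum_(v <- A) bcoef a Gamma v * xi (- v) w|%:E
    <= tau%:E)%E.
Proof.
move=> lin tau0.
set n := size Gamma; pose theta := tau / (2 * n.+1%:R).
have t0 : 0 < theta by rewrite divr_gt0// mulr_gt0.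
have /choice[A0 A0P] : forall jk, exists A0 : {fset ZZ}, forall A : {fset ZZ},
    A0 `<=` A -> ('E_P[fun w =>
      ((X jk w - \sum_(i <- A) a i * xi (jk - i)%R w) ^+ 2)%R] <= (theta ^+ 2)%:E)%E.
  by move=> jk; apply: lin; rewrite exprn_gt0.
exists (\big[fsetU/fset0]_(jk <- Gamma) [fset (rs - jk)%R | rs in A0 jk]) => A sA.
pose err jk w := X jk w - \sum_(v <- A) a (jk + v) * xi (- v) w.
have merr jk : measurable_fun [set: T] (err jk).
  pose g (v : ZZ) (w : T) : R := a (jk + v)%R * xi (- v)%R w.
  apply: measurable_funB => //; rewrite (_ : (fun w => _) = (fun w => \sum_(v <- A) g v w))//.
  by apply: measurable_sum => v; exact: measurable_funM.
have errE jk : jk \in Gamma -> (\int[P]_w `|err jk w|%:E <= (2 * theta)%:E)%E.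
  move=> jkG; apply: integral_norm_le_of_sqr => //.
  have sA' : A0 jk `<=` [fset (jk + v)%R | v in A].
    apply/fsubsetP => rs rsA; apply/imfsetP; exists (rs - jk) => /=; last by rewrite subrKC.
    apply: (fsubsetP sA); apply/bigfcupP; exists jk; first by rewrite jkG.
    by apply/imfsetP; exists rs.
  have := A0P jk _ sA'; apply: le_trans.
  rewrite le_eqVlt; apply/orP; left; apply/eqP; congr expectation; apply/funext => w.
  rewrite /err; congr ((_ - _) ^+ 2).
  rewrite big_imfset /=; last by move=> u v _ _; exact: addrI.
  by apply: eq_bigr => v _; rewrite opprD addNKr.
have sumE w : Ssum X Gamma w - \sum_(v <- A) bcoef a Gamma v * xi (- v) w =
    \sum_(jk <- Gamma) err jk w.
  rewrite /Ssum /err sumrB; congr (_ - _).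
  under eq_bigr do rewrite /bcoef mulr_suml.
  by rewrite exchange_big.
apply: (@le_trans _ _ (\int[P]_w \sum_(jk <- Gamma) `|err jk w|%:E)%E).
  apply: ge0_le_integral => //.
  - apply/measurable_EFinP; apply: measurableT_comp => //.
    under eq_fun do rewrite sumE.
    exact: measurable_sum.
  - apply: emeasurable_sum => jk; apply/measurable_EFinP; exact: measurableT_comp.
  - by move=> w _; rewrite sumE sumEFin lee_fin ler_norm_sum.
rewrite ge0_integral_sum//; last first.
  by move=> jk; apply/measurable_EFinP; exact: measurableT_comp.
rewrite big_seq.
apply: (@le_trans _ _ (\sum_(jk <- Gamma | jk \in Gamma) (2 * theta)%:E)%E).
  by apply: lee_sum.
rewrite -big_seq sumEFin lee_fin big_const_seq count_predT iter_addr_0 -/n -mulr_natr.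
rewrite [leLHS](_ : _ = tau * (n%:R / n.+1%:R)); last first.
  by rewrite /theta; field; rewrite addrC natr1 pnatr_eq0.
by rewrite ler_piMr ?(ltW tau0)// ler_pdivrMr// mul1r ler_nat.
Qed.

End FieldSums.


Section NormalizedSum.
Context {d} {T : measurableType d} {R : realType} (P : probability T R).
Implicit Types (f : R -> R) (M : R).
Local Notation N01 := (@normal_prob R 0 1).

Lemma Rintegral_lipschitz_le M f (U V : T -> R) (tau : R) : bounded_lipschitz M f ->
  measurable_fun [set: T] U -> measurable_fun [set: T] V ->
  (\int[P]_w `|U w - V w|%:E <= tau%:E)%E ->
  `|\int[P]_w f (U w) - \int[P]_w f (V w)| <= M * tau.
Proof.
move=> fB mU mV UV.
have M0 : 0 <= M by apply: le_trans (fB.1 0).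
have mf := bounded_lipschitz_measurable _ _ fB.
have iU : P.-integrable [set: T] (EFin \o (fun w => f (U w))).
  by apply: (bounded_integrable P M); [exact: measurableT_comp|move=> w; exact: fB.1].
have iV : P.-integrable [set: T] (EFin \o (fun w => f (V w))).
  by apply: (bounded_integrable P M); [exact: measurableT_comp|move=> w; exact: fB.1].
rewrite -RintegralB// -lee_fin EFin_normr_Rintegral//; last first.
  exact: (@integrableB _ _ _ P _ measurableT _ _ iU iV).
apply: (@le_trans _ _ (\int[P]_w (M%:E * `|U w - V w|%:E))%E).
  apply: (le_trans (le_abse_integral _ _ _)) => //.
    by apply/measurable_EFinP; apply: measurable_funB; exact: measurableT_comp.
  apply: ge0_le_integral => //.
  - apply: measurableT_comp => //.
    by apply/measurable_EFinP; apply: measurable_funB; exact: measurableT_comp.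
  - apply: emeasurable_funM => //; apply/measurable_EFinP; apply: measurableT_comp => //.
    exact: measurable_funB.
  - by move=> w _; rewrite /= lee_fin; exact: fB.2.
rewrite ge0_integralZl//; first by rewrite EFinM lee_wpmul2l.
by apply/measurable_EFinP; apply: measurableT_comp => //; exact: measurable_funB.
Qed.

End NormalizedSum.

Section SmoothLimit.
Context {R : realType}.
Local Notation N01 := (@normal_prob R 0 1).
Implicit Types (f : R -> R) (M v : R).

(** The two averages evaluate [f] at points that are
    [(1 - Num.sqrt v) * `|y|] apart, and [1 - Num.sqrt v <= 1 - v]. *)
Lemma gauss_average_variance_le M f v : smooth_test M f -> 0 <= v -> v <= 1 ->
  `|gauss_average v f 0 - gauss_average 1 f 0| <= M * (2 * (1 - v)).
Proof.
move=> fS v0 v1.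
have [->|v1'] := eqVneq v 1; first by rewrite !subrr normr0 !mulr0.
have {v1'} v1' : v < 1 by rewrite lt_neqAle v1'.
have [_ _ N2] := @standardized_normal R.
have s1 : Num.sqrt v <= 1 by rewrite -sqrtr1 ler_wsqrtr.
have s0 : v <= Num.sqrt v.
  by rewrite -[leLHS]sqr_sqrtr// expr2 ler_piMl// sqrtr_ge0.
have mS (c : R) : measurable_fun [set: measurableTypeR R] (fun y : R => 0 + c * y).
  by apply: measurable_funD => //; exact: measurable_scale.
apply: (Rintegral_lipschitz_le N01 M f _ _ _ (smooth_test_bl _ _ fS) (mS _) (mS _)).
under eq_integral do rewrite !add0r -mulrBl.
apply: integral_norm_le_of_sqr; first exact: measurable_scale.
  by rewrite subr_gt0.
rewrite unlock /=; under eq_integral do rewrite exprMn EFinM.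
rewrite ge0_integralZl ?lee_fin ?sqr_ge0//; last 2 first.
- by apply/measurable_EFinP; exact: measurable_funX.
- by move=> y _; rewrite lee_fin sqr_ge0.
rewrite N2 mule1 lee_fin sqrtr1 -sqrrN opprB lerXn2r ?nnegrE ?subr_ge0//.
by rewrite lerD2l lerN2.
Qed.

Context {d} {T : measurableType d} (P : probability T R).
Variables (a : ZZ -> R) (xi X : ZZ -> {RV P >-> R}) (Gamma : {fset ZZ}).
Hypotheses (xi_indep : mutually_independent xi)
  (xi_std : forall i, standardized P (xi i)).
Hypothesis (lin : linear_random_field a xi X).
Variables (L eta rho : R).
Hypotheses (L0 : 0 <= L)
  (xi_tail : forall i,
    (\int[P]_(w in [set w | (L < `|xi i w|)%R]) (xi i w ^+ 2)%:E <= eta%:E)%E)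
  (normal_tail : (\int[N01]_(x in [set x : measurableTypeR R | (L < `|x|)%R])
    (x ^+ 2)%:E <= eta%:E)%E).
Hypotheses (sigma0 : 0 < sigma a Gamma)
  (coef_le : forall rs, `|bcoef a Gamma rs / sigma a Gamma| <= rho).

Lemma measurable_Ssum : measurable_fun [set: T] (Ssum X Gamma).
Proof.
rewrite (_ : Ssum X Gamma = (fun w => \sum_(jk <- Gamma) (fun jk w => X jk w) jk w))//.
exact: measurable_sum.
Qed.

(** A finite sum close to [S] in mean and whose weights [c] have a square sum close
    to [1] is compared with a Gaussian variable of the same variance; the
    truncation errors are arbitrarily small and disappear from the bound. *)
Lemma smooth_limit M f : smooth_test M f ->
  `|\int[P]_w f (Ssum X Gamma w / sigma a Gamma) - gauss_average 1 f 0|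
    <= 2 * M * (eta + rho * L).
Proof.
move=> fS; have s0 := sigma0; have cle := coef_le.
set s := sigma a Gamma in s0 cle *; set b := bcoef a Gamma in cle *.
have fB := smooth_test_bl _ _ fS.
have M0 : 0 <= M by apply: le_trans (fB.1 0).
have rho0 : 0 <= rho by apply: le_trans (cle 0).
have eta0 : 0 <= eta.
  rewrite -lee_fin; apply: le_trans normal_tail; apply: integral_ge0 => y _.
  by rewrite lee_fin sqr_ge0.
have sb : square_summable b by exact: square_summable_l2norm_gt0.
apply/ler_addgt0Pr => e e0.
pose tau := e / (3 * (M + 1)).
have M1 : 0 < 3 * (M + 1) by rewrite mulr_gt0// ltr_wpDl.
have tau0 : 0 < tau by rewrite divr_gt0.
have [A1 A1P] := Ssum_approx P a xi X Gamma (tau * s) lin (mulr_gt0 tau0 s0).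
have [A2 A2P] := sum_sqr_approx b (tau * s ^+ 2) sb (mulr_gt0 tau0 (exprn_gt0 2 s0)).
pose A := (A1 `|` A2)%fset.
pose c (i : ZZ) := b (- i) / s; pose r : seq ZZ := map (fun v : ZZ => - v) (enum_fset A).
have ur : uniq r by rewrite map_inj_uniq ?fset_uniq//; exact: oppr_inj.
have wE w : wsum P xi c r w = (\sum_(v <- A) b v * xi (- v) w) / s.
  rewrite /wsum big_map mulr_suml; apply: eq_bigr => v _.
  by rewrite /c opprK mulrAC.
have c2E : \sum_(i <- r) c i ^+ 2 = (\sum_(v <- A) b v ^+ 2) / s ^+ 2.
  by rewrite big_map mulr_suml; apply: eq_bigr => v _; rewrite /c opprK exprMn exprVn.
set V := \sum_(i <- r) c i ^+ 2 in c2E.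
have s2 : 0 < s ^+ 2 by rewrite exprn_gt0.
have V0 : 0 <= V by apply: sumr_ge0 => i _; exact: sqr_ge0.
have V1 : V <= 1.
  rewrite c2E ler_pdivrMr// mul1r; apply: sum_sqr_le => //; exact: fset_uniq.
have V2 : 1 - V <= tau.
  rewrite lerBlDl -lerBlDr c2E ler_pdivlMr// mulrBl mul1r.
  apply: (le_trans A2P); rewrite [leRHS](big_fsetID _ (mem A2))/=.
  rewrite [X in X + _](_ : _ = \sum_(v <- A2) b v ^+ 2); last first.
    congr bigop; congr enum_fset; apply/fsetP => v; rewrite !inE /=.
    by case: (v \in A2); rewrite ?andbF ?orbT.
  by rewrite lerDl sumr_ge0// => v _; exact: sqr_ge0.
have t1 : `|\int[P]_w f (Ssum X Gamma w / s) - \int[P]_w f (wsum P xi c r w)| <= M * tau.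
  apply: Rintegral_lipschitz_le => //.
  - by apply: measurable_funM => //; exact: measurable_Ssum.
  - pose D w := `|Ssum X Gamma w - \sum_(v <- A) b v * xi (- v) w|.
    have mD : measurable_fun [set: T] (fun w => (D w)%:E).
      apply/measurable_EFinP; apply: measurableT_comp => //.
      apply: measurable_funB; first exact: measurable_Ssum.
      rewrite (_ : (fun w => _) = (fun w => s * wsum P xi c r w)).
        by apply: measurable_funM => //; exact: measurable_wsum.
      by apply/funext => w; rewrite wE mulrC divfK// gt_eqF.
    have -> : tau%:E = ((s^-1)%:E * (tau * s)%:E)%E.
      by rewrite -EFinM mulrC mulfK// gt_eqF.
    apply: (@le_trans _ _ (\int[P]_w ((s^-1)%:E * (D w)%:E))%E).
      rewrite le_eqVlt; apply/orP; left; apply/eqP; apply: eq_integral => w _.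
      by rewrite wE -mulrBl normrM (ger0_norm (_ : 0 <= s^-1)) ?invr_ge0 ?ltW// -EFinM mulrC.
    rewrite ge0_integralZl//; last 2 first.
    + by move=> w _; rewrite lee_fin normr_ge0.
    + by rewrite lee_fin invr_ge0 ltW.
    apply: lee_wpmul2l; first by rewrite lee_fin invr_ge0 ltW.
    by apply: A1P; exact: fsubsetUl.
have cr i : i \in r -> `|c i| <= rho by move=> _; exact: cle.
have t2 := lindeberg_replacement P xi c xi_indep xi_std L eta rho L0 xi_tail
  normal_tail M f r fS ur cr.
have t3 := gauss_average_variance_le M f V fS V0 V1.
have t2' : 2 * M * (eta + rho * L) * V <= 2 * M * (eta + rho * L).
  by rewrite ler_piMr// !mulr_ge0// addr_ge0// mulr_ge0.
rewrite -/V in t2.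
have -> : \int[P]_w f (Ssum X Gamma w / s) - gauss_average 1 f 0 =
  (\int[P]_w f (Ssum X Gamma w / s) - \int[P]_w f (wsum P xi c r w)) +
  (\int[P]_w f (wsum P xi c r w) - gauss_average V f 0) +
  (gauss_average V f 0 - gauss_average 1 f 0) by ring.
have eE : e = 3 * (M + 1) * tau by rewrite /tau mulrC divfK// gt_eqF.
apply: (le_trans (ler_normD _ _)); apply: (le_trans (lerD (ler_normD _ _) t3)).
apply: (le_trans (lerD (lerD t1 (le_trans t2 t2')) (lexx _))).
rewrite eE; have : M * (1 - V) <= M * tau by rewrite ler_wpM2l.
by lra.
Qed.

End SmoothLimit.

(** * Comparison of distribution functions *)

Section CdfComparison.
Context {d} {T : measurableType d} {R : realType} (P : probability T R).
Implicit Types (k z : R) (W : T -> R).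

(** Decreases from 1 to 0 on the interval from [z] to [z + 3 / k]. *)
Definition smooth_cutoff k z (x : R) : R := step (- k * x + (k * z + 3)).

Lemma smooth_test_cutoff k z : 1 <= k -> smooth_test (8 * k ^+ 3) (smooth_cutoff k z).
Proof.
move=> k1; have k0 : 0 <= k by apply: le_trans k1.
rewrite -[in X in 8 * X](ger0_norm k0) -normrN.
by apply: smooth_test_affine; [rewrite normrN ger0_norm|exact: smooth_test_step].
Qed.

Lemma smooth_cutoff_le k z x : x <= z -> 0 <= k -> smooth_cutoff k z x = 1.
Proof.
move=> xz k0; apply: step_ge3; have : 0 <= k * (z - x) by rewrite mulr_ge0// subr_ge0.
by lra.
Qed.

Lemma smooth_cutoff_gt k z x : 0 < k -> z + 3 / k < x -> smooth_cutoff k z x = 0.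
Proof.
move=> k0 zx; apply: step_le0.
have : k * (z + 3 / k) < k * x by rewrite ltr_pM2l.
rewrite mulrDr mulrCA divff ?gt_eqF// mulr1 => h; lra.
Qed.

Lemma Rintegral_cutoff k z W : 1 <= k -> measurable_fun [set: T] W ->
  fine (P [set w | W w <= z]) <= \int[P]_w smooth_cutoff k z (W w)
    <= fine (P [set w | W w <= z + 3 / k]).
Proof.
move=> k1 mW; have k0 : 0 < k by apply: lt_le_trans k1.
have [f0 _] := smooth_test_cutoff k z k1.
have fB := smooth_test_bl _ _ (smooth_test_cutoff k z k1).
have mD y : measurable [set w | W w <= y].
  rewrite (_ : [set w | _] = [set: T] `&` W @^-1` `]-oo, y]); first exact: mW.
  by rewrite setTI; apply/seteqP; split=> w /=; rewrite in_itv.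
have iD y : P.-integrable [set: T] (EFin \o \1_[set w | W w <= y]).
  apply: (bounded_integrable P 1) => [|w]; first exact: measurable_indic.
  by rewrite indicE; case: (_ \in _); rewrite ?normr1 ?normr0.
have PE y : fine (P [set w | W w <= y]) = \int[P]_w \1_[set w | W w <= y] w.
  by rewrite /Rintegral integral_indic// setIT.
have iC : P.-integrable [set: T] (EFin \o (fun w => smooth_cutoff k z (W w))).
  apply: (bounded_integrable P (8 * k ^+ 3)) => [|w]; last exact: fB.1.
  by apply: measurableT_comp => //; exact: bounded_lipschitz_measurable fB.
rewrite !PE; apply/andP; split; apply: le_Rintegral => // w _; rewrite indicE.
  have [|] := boolP (w \in _); last by move=> _; exact: f0.
  by rewrite inE /= => Wz; rewrite smooth_cutoff_le// ltW.
have [|] := boolP (w \in _).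
  by move=> _; have /andP[] := step_ge0_le1 (- k * W w + (k * z + 3)).
move=> nW; rewrite smooth_cutoff_gt// ltNge; apply/negP => h; move/negP: nW; apply.
by rewrite inE.
Qed.

End CdfComparison.

Section Phi.
Context {R : realType}.
Implicit Types (z h : R).

Lemma PhiE z : Phi z = fine (normal_prob 0 1 [set x : R | x <= z]).
Proof.
by rewrite /Phi; congr (fine (normal_prob _ _ _)).
Qed.

Lemma normal_peak1_le1 : normal_peak (1 : R) <= 1.
Proof.
rewrite /normal_peak expr1n mul1r invf_le1; last first.
  by rewrite sqrtr_gt0 pmulrn_lgt0// pi_gt0.
rewrite -[leLHS]sqrtr1 ler_wsqrtr// mulr2n.
by have := @pi_ge2 R; lra.
Qed.

(** The standard normal density is at most 1. *)
Lemma Phi_lipschitz z h : 0 <= h -> Phi (z + h) <= Phi z + h.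
Proof.
move=> h0; rewrite /Phi.
have fin (A : set (measurableTypeR R)) : measurable A -> normal_prob 0 1 A \is a fin_num.
  exact: fin_num_measure.
have -> : `]-oo, z + h]%classic = `]-oo, z] `|` `]z, z + h].
  by rewrite -itv_bndbnd_setU// bnd_simp lerDl.
rewrite measureU//; last first.
  apply/seteqP; split=> // x [] /=; rewrite !in_itv /= => xz /andP[zx _].
  by move: (lt_le_trans zx xz); rewrite ltxx.
rewrite fineD ?fin// lerD2l -lee_fin fineK ?fin//.
apply: (@le_trans _ _ (\int[lebesgue_measure]_(x in `]z, (z + h)%R]) (cst 1%E) x)%E).
  apply: ge0_le_integral => //.
  - by move=> x _; rewrite lee_fin normal_pdf_ge0.
  - by apply/measurable_EFinP/measurable_funTS; exact: measurable_normal_pdf.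
  - move=> x _; rewrite lee_fin; apply: le_trans normal_peak1_le1.
    by apply: normal_pdf_ub; rewrite oner_neq0.
rewrite integral_cst//= mul1e lebesgue_measure_itv/= lte_fin ltrDl.
case: ifP => _; last by rewrite lee_fin.
by rewrite -EFinB addrAC subrr add0r.
Qed.

End Phi.

Theorem corollary2 (R : realType) (calH : set (distribution_function R))
    (mean0 : forall H, calH H ->
       (\int[lebesgue_stieltjes_measure H]_x x%:E = 0)%E)
    (var1 : forall H, calH H ->
       (\int[lebesgue_stieltjes_measure H]_x (x ^+ 2)%:E = 1)%E)
    (unif_int :
       ereal_sup [set (\int[lebesgue_stieltjes_measure H]_(x in
                         [set x : R | (c < `|x|)%R]) (x ^+ 2)%:E)%E
                 | H in calH] @[c --> +oo%R] --> 0%E) :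
  forall eps : R, 0 < eps ->
  exists kappa0 : R, 0 < kappa0 /\
  forall kappa : R, kappa0 <= kappa ->
  forall (a : ZZ -> R) (Gamma : {fset ZZ}), Rclass kappa (a, Gamma) ->
  forall F : distribution_function R, calH F ->
  forall (d : measure_display) (T : measurableType d) (P : probability T R)
         (xi X : ZZ -> {RV P >-> R}),
    iid F xi -> linear_random_field a xi X ->
    (ereal_sup [set `|Gdf a X Gamma z - Phi z|%:E | z in [set: R]]
       <= eps%:E)%E.
Proof.
move=> eps eps0.
(* 3 / k, the width of the smoothing, costs at most eps / 2 *)
pose k := 1 + 6 / eps.
have k1 : 1 <= k by rewrite lerDl divr_ge0// ltW.
have k0 : 0 < k by apply: lt_le_trans k1.
have k3 : 3 / k <= eps / 2.
  rewrite ler_pdivrMr// /k mulrDr mulr1 (_ : eps / 2 * (6 / eps) = 3); last by field; rewrite gt_eqF.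
  by rewrite lerDr divr_ge0// ltW.
pose M := 8 * k ^+ 3.
have M0 : 0 < M by rewrite mulr_gt0// exprn_gt0.
(* eta, L and rho make the replacement error 2 * M * (eta + rho * L) equal to
   eps / 2 *)
pose eta := eps / (8 * M).
have eta0 : 0 < eta by rewrite divr_gt0// mulr_gt0.
have [L1 L1P] : exists L1 : R, forall c, L1 < c -> forall H, calH H ->
    (\int[lebesgue_stieltjes_measure H]_(x in [set x : R | (c < `|x|)%R]) (x ^+ 2)%:E
      <= eta%:E)%E.
  have : \forall c \near +oo%R, (ereal_sup [set (\int[lebesgue_stieltjes_measure H]_(x in
                         [set x : R | (c < `|x|)%R]) (x ^+ 2)%:E)%E
                 | H in calH] < eta%:E)%E.
    have : nbhs (0%E : \bar R) [set y | (y < eta%:E)%E].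
      have o := @open_ereal_lt_ereal R.
      by apply: open_nbhs_nbhs; split; [exact: o|rewrite /= lte_fin].
    by move/unif_int.
  move=> [L1 [_ L1P]]; exists L1 => c /L1P /ltW h H HH.
  by apply: le_trans h; apply: ereal_sup_ubound; exists H.
pose L := Num.max (L1 + 1) (Num.max 1 (64 / eta)).
have LL1 : L1 < L by rewrite lt_max ltrDl ltr01.
have L1' : 1 <= L by rewrite !le_max lexx orbT.
have Leta : 64 / eta <= L by rewrite !le_max lexx !orbT.
have L0 : 0 < L by apply: lt_le_trans L1'.
have normal_tail :
    (\int[normal_prob 0 1]_(x in [set x : measurableTypeR R | (L < `|x|)%R])
      (x ^+ 2)%:E <= eta%:E)%E.
  apply: (le_trans (normal_tail_le L L0)); rewrite lee_fin.
  rewrite ler_pdivrMr ?exprn_gt0// mulrC -ler_pdivrMr//.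
  by apply: (le_trans Leta); rewrite expr2 ler_peMr// ltW.
pose rho := eps / (8 * M * L).
have rho0 : 0 < rho by rewrite divr_gt0// !mulr_gt0.
(* each of the two terms of bcoef_sup_le gets half of rho * sigma *)
pose K := (Num.bound (6 / rho)).+1.
have K6 : 3 / K%:R <= rho / 2.
  have : 6 / rho < K%:R.
    apply: lt_trans (_ : (Num.bound (6 / rho))%:R < _); last by rewrite ltr_nat.
    by apply: archi_boundP; rewrite divr_ge0// ltW.
  rewrite ltr_pdivrMr// => h; rewrite ler_pdivrMr ?ltr0n//.
  by lra.
exists (8 * (K ^ 4)%:R / rho); split.
  by rewrite divr_gt0// mulr_gt0// ltr0n expn_gt0.
move=> kappa kK a Gamma [/= sa a0 rect ksig] F HF d T P xi X [xi_indep xi_cdf] lin.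
have kappa0 : 0 < kappa.
  by apply: lt_le_trans kK; rewrite divr_gt0// mulr_gt0// ltr0n expn_gt0.
have s0 : 0 < sigma a Gamma by apply: lt_le_trans ksig; rewrite mulr_gt0.
have coef_le rs : `|bcoef a Gamma rs / sigma a Gamma| <= rho.
  rewrite normrM normfV (gtr0_norm s0) ler_pdivrMr//.
  apply: (le_trans (bcoef_sup_le a Gamma K rs (ltn0Sn _) sa rect s0)).
  rewrite [X in _ + X](_ : _ = 3 / K%:R * sigma a Gamma); last by rewrite mulrAC.
  rewrite [leRHS](_ : _ = rho / 2 * sigma a Gamma + rho / 2 * sigma a Gamma); last by field.
  apply: lerD; last by rewrite ler_wpM2r// ltW.
  apply: (@le_trans _ _ (rho / 2 * (kappa * l2norm a))).
    rewrite mulrA ler_wpM2r ?l2norm_ge0//.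
    by move: kK; rewrite ler_pdivrMr// => h; lra.
  by rewrite ler_wpM2l// divr_ge0// ltW.
have xi_std i : standardized P (xi i).
  exact: (standardized_of_cdf P F (xi i) (xi_cdf i) (mean0 F HF) (var1 F HF)).
have xi_tail i :
    (\int[P]_(w in [set w | (L < `|xi i w|)%R]) (xi i w ^+ 2)%:E <= eta%:E)%E.
  by rewrite -(tail_of_cdf P F (xi i) (xi_cdf i)); exact: L1P.
have limit z := smooth_limit P a xi X Gamma xi_indep xi_std lin L eta rho (ltW L0)
  xi_tail normal_tail s0 coef_le M (smooth_cutoff k z) (smooth_test_cutoff k z k1).
have errE : 2 * M * (eta + rho * L) = eps / 2.
  by rewrite /eta /rho; field; rewrite !gt_eqF.
have mW : measurable_fun [set: T] (fun w => Ssum X Gamma w / sigma a Gamma).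
  by apply: measurable_funM => //; exact: measurable_Ssum.
have gaussE z : gauss_average 1 (smooth_cutoff k z) 0 =
    \int[normal_prob 0 1]_x smooth_cutoff k z x.
  by rewrite /gauss_average /average sqrtr1; apply: eq_Rintegral => x _; rewrite add0r mul1r.
have Gbound z := Rintegral_cutoff P k z _ k1 mW.
have Nbound z := Rintegral_cutoff (normal_prob (0 : R) 1) k z (fun x => x) k1 (@measurable_id _ _ _).
have h30 : 0 <= 3 / k by rewrite divr_ge0// ltW.
apply: ge_ereal_sup => _ [z _ <-]; rewrite lee_fin ler_norml.
apply/andP; split.
  have /andP[_ g1] := Gbound (z - 3 / k); have /andP[n1 _] := Nbound (z - 3 / k).
  rewrite subrK in g1.
  have := limit (z - 3 / k); rewrite errE gaussE ler_norml => /andP[l1 _].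
  have := Phi_lipschitz (z - 3 / k) (3 / k) h30; rewrite subrK => p1.
  rewrite -PhiE in n1; rewrite /Gdf.
  by lra.
have /andP[g1 _] := Gbound z; have /andP[_ n1] := Nbound z.
have := limit z; rewrite errE gaussE ler_norml => /andP[_ l1].
have p1 := Phi_lipschitz z (3 / k) h30.
rewrite -PhiE in n1; rewrite /Gdf.
by lra.
Qed.
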